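(* Let $\mathcal I\subset\Pi$ have chains $C_1,\dots,C_l$ ($l\ge 2$) of lengths $c_i=|C_i|$, and assume $c_1=c_l=:c$ and $c_j\ne c$ for all $1<j<l$. Let $r$ be the number of chains $C_i$ of length $>c$ and let $s+2c$ be the sum of the lengths of the remaining chains. Then the generator $f_{\mathcal I}(l)$ of the principal ideal $I(\overline{\mathcal V}_{T_{\mathcal I}(l)})$ of $S(\mathfrak m_{\mathcal I}^-)$ is the highest common divisor of the (non-vanishing) $(s+c)\times(s+c)$ minors of the matrix $\mathcal M_{\mathcal I}^{\,r+1}$ (the $(r+1)$-th power of $\mathcal M_{\mathcal I}$).
   Context: Ground field $\mathbb C$. $\mathfrak g=\mathfrak{gl}_n$ with matrix units $e_{i,j}$, $\mathbf G=GL_n$, $\mathbf B$ the upper-triangular group, $\mathfrak n$ the strictly upper-triangular matrices, $\Pi=\{\alpha_1,\dots,\alpha_{n-1}\}$ the simple roots ($\alpha_i$ is the root of $e_{i,i+1}$). An orbital variety is an irreducible component of $\mathcal O\cap\mathfrak n$ for a nilpotent orbit $\mathcal O$. For $w\in S_n$ let $\mathfrak n\cap{}^w\mathfrak n=\mathrm{span}\{e_{i,j}: i<j,\ w^{-1}(i)<w^{-1}(j)\}$, let $\mathcal O$ be the nilpotent orbit dense in $\mathbf G(\mathfrak n\cap{}^w\mathfrak n)$ and $\mathcal V_w=\overline{\mathbf B(\mathfrak n\cap{}^w\mathfrak n)}\cap\mathcal O$. By Steinberg these are all the orbital varieties and $\mathcal V_w=\mathcal V_y$ iff $Q(w)=Q(y)$,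 $Q(w)$ being the Robinson–Schensted row-insertion tableau of the word $[w(1),\dots,w(n)]$; $\mathcal V_T:=\mathcal V_w$ if $Q(w)=T$. Given $\mathcal I\subset\Pi$, partition $\{1,\dots,n\}$ into maximal intervals $C_1,\dots,C_l$ (chains, in increasing order) such that $i,i+1$ lie in the same interval iff $\alpha_i\in\mathcal I$. $\mathfrak m_{\mathcal I}=\mathrm{span}\{e_{a,b}: a\in C_i,\ b\in C_j,\ i<j\}$ is the nilradical of the corresponding block upper-triangular parabolic. $T_{\mathcal I}$ is the standard tableau whose $r$-th row consists of the $r$-th smallest elements of all chains of length $\ge r$. When $c_1=c_l=c$ and $c_j\ne c$ for $1<j<l$, $T_{\mathcal I}(l)$ is the standard tableau obtained from $T_{\mathcal I}$ by moving $n$ from row $c$ to row $c+1$ (rows rearranged increasingly, left-justified). The closure $\overline{\mathcal V}_{T_{\mathcal I}(l)}$ is then an irreducible hypersurface of $\mathfrak m_{\mathcal I}$. $x_{j,i}$ is the linear function on $\mathfrak g$ with value $-1$ on $e_{i,j}$ and $0$ on other matrix units. $S(\mathfrak m_{\mathcal I}^-)$ is the polynomial ring in the $x_{a,b}$ with $e_{b,a}\in\mathfrak m_{\mathcal I}$, i.e. the polynomial functions on $\mathfrak m_{\mathcal I}$; here $I(\overline{\mathcal V}_{T_{\mathcal I}(l)})$ is the ideal of $\overline{\mathcal V}_{T_{\mathcal I}(l)}$ in this ring, and $f_{\mathcal I}(l)$ its generator, defined up to a non-zero scalar. $\mathcal M_{\mathcal I}$ is the $n\times n$ matrix with $(a,b)$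 entry $x_{a,b}$ if $e_{b,a}\in\mathfrak m_{\mathcal I}$ and $0$ otherwise. *)

(* Defs.v *)
From HB Require Import structures.
From mathcomp Require Import all_boot all_order all_fingroup all_algebra.
From mathcomp Require Import classical_sets reals.
From mathcomp Require Import complex mpoly.

Set Implicit Arguments.
Unset Strict Implicit.
Unset Printing Implicit Defensive.

Import GRing.Theory.
Local Open Scope ring_scope.

(* Indices are shifted by one: 'I_n is {0, ..., n-1}, it stands for
   {1, ..., n}, and the entries of tableaux are shifted accordingly.  Chains
   are numbered from 0 and the rows of a tableau are numbered from 0. *)

Section Tableaux.

Definition tableau := seq (seq nat).

Fixpoint row_insert (T : tableau) (x : nat) : tableau :=
  if T is row :: T' then
    let k := find (fun y => (x < y)%N) row in
    if (k < size row)%N then set_nth 0%N row k x :: row_insert T' (nth 0%N row k)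
    else rcons row x :: T'
  else [:: [:: x]].

Definition RS_insertion (word : seq nat) : tableau := foldl row_insert [::] word.

Definition Q (n : nat) (w : 'S_n) : tableau :=
  RS_insertion [seq nat_of_ord (w i) | i <- enum 'I_n].

(* Move the entry [x] from row [k] to row [k.+1], creating the latter if needed. *)
Definition move_down (T : tableau) (x k : nat) : tableau :=
  mkseq (fun i => let row := nth [::] T i in
           sort leq (if i == k then rem x row
                     else if i == k.+1 then x :: row else row))
        (maxn (size T) k.+2).

End Tableaux.

Section Chains.
Variables (n : nat) (I : {set 'I_n.-1}).

(* [i : 'I_n.-1] stands for the simple root joining the indices [i] and [i.+1]
   of ['I_n], so a new chain starts at [i.+1] iff [i \notin I]. *)
Definition chain_index (a : 'I_n) : nat :=
  #|[set i : 'I_n.-1 | (i < a)%N && (i \notin I)]|.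

Definition nchains : nat := #|~: I|.+1.

Definition chain (j : nat) : {set 'I_n} := [set a | chain_index a == j].

Definition chain_length (j : nat) : nat := #|chain j|.

Definition chain_seq (j : nat) : seq nat := [seq nat_of_ord a | a <- enum (chain j)].

(* [e_(a,b)] belongs to the nilradical m_I *)
Definition in_nilrad (a b : 'I_n) : bool := (chain_index a < chain_index b)%N.

Definition T_chains : tableau :=
  mkseq (fun i => sort leq [seq nth 0%N (chain_seq j) i
                               | j <- iota 0 nchains & (i < chain_length j)%N])
        (\max_(j < nchains) chain_length j).

(* T_I(l) when the first and the last chains have equal length c: the largest
   entry moves from the c-th to the (c+1)-st row. *)
Definition T_chains_last : tableau :=
  move_down T_chains n.-1 (chain_length 0).-1.

End Chains.

Section OrbitalVarieties.
Variables (C : fieldType) (n : nat).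

Definition zariski_closure (A : set 'M[C]_n) : set 'M[C]_n :=
  fun X => forall p : {mpoly C[n * n]},
    (forall Y, A Y -> p.@[fun k => mxvec Y 0 k] = 0) ->
    p.@[fun k => mxvec X 0 k] = 0.

Definition conj_set (H A : set 'M[C]_n) : set 'M[C]_n :=
  fun X => exists g Y, [/\ H g, A Y & X = g *m Y *m invmx g].

Definition group_G : set 'M[C]_n := fun g => g \in unitmx.

(* [is_trig_mx] means lower triangular *)
Definition group_B : set 'M[C]_n := fun g => g \in unitmx /\ is_trig_mx g^T.

Definition nilpotent_orbit (O : set 'M[C]_n) : Prop :=
  exists N : 'M[C]_n, (exists k, N ^+ k = 0) /\ O = conj_set group_G (set1 N).

Definition dense_in (A D : set 'M[C]_n) : Prop :=
  (forall X, A X -> D X) /\ (forall X, D X -> zariski_closure A X).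

Definition n_cap (w : 'S_n) : set 'M[C]_n :=
  fun X => forall i j : 'I_n,
    ~~ ((i < j)%N && ((w^-1)%g i < (w^-1)%g j)%N) -> X i j = 0.

Definition V_perm (w : 'S_n) : set 'M[C]_n :=
  fun X => exists O : set 'M[C]_n,
    [/\ nilpotent_orbit O, dense_in O (conj_set group_G (n_cap w)),
        zariski_closure (conj_set group_B (n_cap w)) X & O X].

(* V_T is V_w for any [w] with [Q w = T]; by Steinberg's theorem this does not
   depend on the choice of [w]. *)
Definition V_tab (T : tableau) : set 'M[C]_n :=
  fun X => exists w : 'S_n, Q w = T /\ V_perm w X.

End OrbitalVarieties.

Section NilradicalPolynomials.
Variables (C : fieldType) (n : nat) (I : {set 'I_n.-1}).

(* The pairs (a, b) with [e_(b,a)] in m_I, indexing the variables x_(a,b). *)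
Definition coord : finType := {ab : 'I_n * 'I_n | in_nilrad I ab.2 ab.1}.

Definition S_nilrad := {mpoly C[#|coord|]}.

(* The value at [X] of the polynomial function [p]; x_(a,b) takes the value -1
   on [e_(b,a)]. *)
Definition eval_nilrad (X : 'M[C]_n) (p : S_nilrad) : C :=
  p.@[fun k => let ab := val (enum_val k : coord) in - X ab.2 ab.1].

Definition vanishing_ideal (A : set 'M[C]_n) : set S_nilrad :=
  fun p => forall X, A X -> eval_nilrad X p = 0.

Definition M_nilrad : 'M[S_nilrad]_n :=
  \matrix_(a, b) (if insub (a, b) is Some u then 'X_(enum_rank (u : coord)) else 0).

End NilradicalPolynomials.

Section Divisibility.
Variable A : comNzRingType.

Definition divides (f g : A) : Prop := exists q, g = q * f.

Definition generates (f : A) (J : set A) : Prop := forall p, J p <-> divides f p.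

Definition is_hcd (f : A) (S : set A) : Prop :=
  (forall p, S p -> divides f p) /\
  (forall g, (forall p, S p -> divides g p) -> divides g f).

Definition nonzero_minor (n k : nat) (M : 'M[A]_n) : set A :=
  fun d => d != 0 /\ exists f g : 'I_k -> 'I_n,
    [/\ {homo f : i j / (i < j)%N}, {homo g : i j / (i < j)%N}
      & d = \det (mxsub f g M)].

End Divisibility.

(* Main.v *)
Require Import Defs.
From HB Require Import structures.
From mathcomp Require Import all_boot all_order all_fingroup all_algebra.
From mathcomp Require Import classical_sets reals.
From mathcomp Require Import complex mpoly zify ring.

(** Grade S(m_I^-) by the characters of the diagonal torus.  A minor of M_I^(r+1)
    is homogeneous, hence so is each of its factors g.  Evaluating g at suitable
    0-1 matrices X_rho (disjoint unions of paths, at which some minor equals 1)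
    shows that the weight of a common divisor g is m on the first chain, -m on
    the last one and 0 elsewhere, and m is 0 or 1 because a minor has weight at
    most 1 at each vertex.  If m = 0, then g is constant.

    Let y be the reading word of T_I(l).  Both the minors and the common divisors
    with m = 1 vanish on the B-conjugates of n cap y(n): the former because
    X^(r+1) has rank < s + c there, the latter by their weight.  A polynomial
    vanishing on B(n cap w(n)) vanishes on B(n cap w'(n)) for every w' Knuth
    equivalent to w, so both lie in the ideal of the closure of V_(T_I(l)), which
    is proper since V_(T_I(l)) contains a nilpotent matrix with Jordan blocks
    along the rows of T_I(l).  So the generator f is a common divisor with m = 1,
    and any common divisor g is constant or of the form q f, with q of weight 0
    and thus constant. *)

Set Implicit Arguments.
Unset Strict Implicit.
Unset Printing Implicit Defensive.

Import Order.TTheory GRing.Theory Num.Theory.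
Local Open Scope ring_scope.

(** * Gradings by weights *)

(** The numbers [s + c] and [r + 1] mark the place where moving the entry n costs one unit of rank.
    The first c rows of T_I hold s + c + c(r + 1) cells; along c paths through them, a power r + 1
    loses at most r + 1 vertices per path, so rank at least s + c remains. In T_I(l) these rows have
    one cell less, and the rows below are too short to survive that power.

    The condition on the middle chains enters through the weights: a weight of a common divisor
    vanishes on every chain of length other than c, so only the first and the last chain can carry
    it.

    All common divisors are treated together, not just the generator, because the Borel group does
    not respect the torus grading but does permute the common divisors. A common divisor moved by
    the adjoint action can therefore be classified by its weight afresh. This is how vanishing on n
    cap y(n), which is a matter of weights, spreads to all B-conjugates. *)

Section GradedFactors.
Variables (F : idomainType) (N : nat).
Implicit Types (p q : {mpoly F[N]}) (m : 'X_{1..N}) (w : 'I_N -> nat).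

Definition mweight w m : nat := (\sum_k m k * w k)%N.

Definition whomog w (d : nat) p : Prop :=
  forall m, m \in msupp p -> mweight w m = d.

(** The substitution X_k -> X_k T^(w k). The coefficient of T^d is the component of weight d, so
    homogeneity of [p] becomes the statement that this is a monomial in T. *)
Definition weight_poly w p : {poly {mpoly F[N]}} :=
  mmap (polyC \o @mpolyC N F) (fun k => ('X_k)%:P * 'X^(w k)) p.

Lemma weight_poly_mmap1 w m :
  mmap1 (fun k => ('X_k : {mpoly F[N]})%:P * 'X^(w k)) m
    = ('X_[m])%:P * 'X^(mweight w m).
Proof.
rewrite /mmap1 /mweight mpolyXE_id rmorph_prod -prodrXr -big_split /=.
by apply: eq_bigr => k _; rewrite exprMn rmorphXn /= -exprM mulnC.
Qed.

Lemma coef_weight_poly w p d m :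
  ((weight_poly w p)`_d)@_m = if mweight w m == d then p@_m else 0.
Proof.
rewrite /weight_poly /mmap /= coef_sum raddf_sum /=.
under eq_bigr => m' _.
  rewrite weight_poly_mmap1 mulrA -polyCM coefCM coefXn mul_mpolyC.
  rewrite eq_sym mulr_natr mcoeffMn mcoeffZ mcoeffX.
  over.
case: (boolP (m \in msupp p)) => [mp|mNp].
  rewrite (bigD1_seq m) //= eqxx mulr1 big1 ?addr0 => [|m' /negPf->].
    by case: ifP => _; rewrite ?mulr1n ?mulr0n.
  by rewrite mulr0 mul0rn.
rewrite big1_seq => [|m' /andP[_ m'p]].
  by rewrite memN_msupp_eq0 //; case: ifP.
case: eqP => [mm'|_]; last by rewrite mulr0 mul0rn.
by rewrite -mm' m'p in mNp.
Qed.

Lemma weight_poly_homog w d p :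
  whomog w d p <-> weight_poly w p = p *: 'X^d.
Proof.
split=> [hp|hp m mp].
  apply/polyP => i; apply/mpolyP => m; rewrite coef_weight_poly coefZ coefXn.
  rewrite mulr_natr mcoeffMn.
  case: (boolP (m \in msupp p)) => [/hp->|mNp]; last first.
    by rewrite memN_msupp_eq0 // mul0rn; case: ifP.
  by rewrite eq_sym; case: eqP => _; rewrite ?mulr1n ?mulr0n.
have := coef_weight_poly w p (mweight w m) m.
rewrite hp eqxx coefZ coefXn mulr_natr mcoeffMn.
case: eqP => // _; rewrite mulr0n => /esym p0.
by move: mp; rewrite mcoeff_msupp p0 eqxx.
Qed.

Lemma weight_polyM w : {morph weight_poly w : p q / p * q}.
Proof.
move=> p q; rewrite /weight_poly.
by rewrite (commr_mmap_is_multiplicative _ _).1 // => *; apply: mulrC.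
Qed.

End GradedFactors.

(** For d > 0 one of the factors vanishes at 0, so a factor ['X] can be cancelled; for d = 0 both
    factors are constant by degree. *)
Lemma monomial_factor (A : idomainType) (p q : {poly A}) c d :
  c != 0 -> p * q = c *: 'X^d -> exists a e, p = a *: 'X^e.
Proof.
move=> c0; elim: d p q => [|d IHd] p q.
  rewrite expr0 alg_polyC => pq; exists p`_0, 0%N.
  have: size (p * q) = 1%N by rewrite pq size_polyC c0.
  have pq0: p * q != 0 by rewrite pq polyC_eq0.
  have [p0 q0] : p != 0 /\ q != 0.
    by move: pq0; rewrite mulf_eq0 negb_or => /andP.
  rewrite size_mul // expr0 alg_polyC => hs; apply: size1_polyC.
  move: p0 q0 hs; rewrite -!size_poly_gt0; lia.
move=> pq.
have : p.[0] * q.[0] == 0.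
  by rewrite -hornerM pq hornerZ hornerXn expr0n mulr0.
have XI: injective (fun u : {poly A} => u * 'X) by apply: mulIf; rewrite polyX_eq0.
rewrite mulf_eq0 => /orP[/factor_theorem[p' p'E]|/factor_theorem[q' q'E]].
  have [|a [e p'Xe]] := IHd p' q.
    by apply: XI; rewrite mulrAC -scalerAl -exprSr -pq p'E subr0.
  by exists a, e.+1; rewrite p'E subr0 p'Xe -scalerAl exprSr.
apply: (IHd p q'); apply: XI.
by rewrite -mulrA -scalerAl -exprSr -pq q'E subr0.
Qed.

Lemma whomog_factor (F : idomainType) N (w : 'I_N -> nat) d (p q : {mpoly F[N]}) :
  p * q != 0 -> whomog w d (p * q) -> exists e, whomog w e p.
Proof.
move=> pq0 /weight_poly_homog; rewrite weight_polyM => /monomial_factor.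
case=> // a [e pE]; exists e => m mp.
have := coef_weight_poly w p (mweight w m) m.
rewrite eqxx pE coefZ coefXn mulr_natr mcoeffMn.
case: eqP => // _; rewrite mulr0n => /esym p0.
by move: mp; rewrite mcoeff_msupp p0 eqxx.
Qed.

Section IntegerWeights.
Variables (F : idomainType) (N : nat).
Implicit Types (p q : {mpoly F[N]}) (m : 'X_{1..N}) (w : 'I_N -> int).

Definition iweight w m : int := \sum_k w k *+ m k.

Definition ihomog w (e : int) p : Prop :=
  forall m, m \in msupp p -> iweight w m = e.

Lemma iweightD w m1 m2 : iweight w (m1 + m2)%MM = iweight w m1 + iweight w m2.
Proof.
by rewrite /iweight -big_split; apply: eq_bigr => k _; rewrite mnmDE mulrnDr.
Qed.

Lemma ihomog0 w e : ihomog w e 0.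
Proof. by move=> m; rewrite msupp0. Qed.

Lemma ihomogC w a : ihomog w 0 a%:MP.
Proof.
move=> m; rewrite msuppC; case: ifP => // _; rewrite inE => /eqP->.
by rewrite /iweight big1 // => k _; rewrite mnm0E.
Qed.

Lemma ihomogX w k : ihomog w (w k) 'X_k.
Proof.
move=> m; rewrite msuppX inE => /eqP->.
rewrite /iweight (bigD1 k) //= mnm1E eqxx big1 ?addr0 // => j /negPf.
by rewrite mnm1E eq_sym => ->.
Qed.

Lemma ihomogM w e1 e2 p q :
  ihomog w e1 p -> ihomog w e2 q -> ihomog w (e1 + e2) (p * q).
Proof.
move=> hp hq m /msuppM_le /allpairsP[[m1 m2] /= [/hp <- /hq <- ->]].
exact: iweightD.
Qed.

Lemma ihomog_sum w e (T : Type) (s : seq T) (P : pred T) (f : T -> {mpoly F[N]}) :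
  (forall i, P i -> ihomog w e (f i)) -> ihomog w e (\sum_(i <- s | P i) f i).
Proof.
move=> hf; elim/big_rec: _ => [|i p Pi hp m]; first exact: ihomog0.
by move=> /msuppD_le; rewrite mem_cat => /orP[/(hf i Pi)|/hp].
Qed.

Lemma ihomog_prod w (T : Type) (s : seq T) (e : T -> int) (f : T -> {mpoly F[N]}) :
  (forall i, ihomog w (e i) (f i)) ->
  ihomog w (\sum_(i <- s) e i) (\prod_(i <- s) f i).
Proof.
move=> hf; elim/big_rec2: _ => [|i p e' _ hp]; last exact: ihomogM.
by rewrite -mpolyC1; apply: ihomogC.
Qed.

Lemma iweight_nat (w0 : 'I_N -> nat) m : iweight (fun k => (w0 k)%:Z) m = (mweight w0 m)%:Z.
Proof.
rewrite /iweight /mweight (big_morph Posz PoszD (erefl _)).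
by apply: eq_bigr => k _; rewrite PoszM -mulr_natl natz.
Qed.

End IntegerWeights.

(** * Torus weights on the polynomial functions on m_I *)

Section NilradWeights.
Variables (F : fieldType) (n : nat) (I : {set 'I_n.-1}).
Implicit Types (p q : S_nilrad F I) (m : 'X_{1..#|Defs.coord I|}) (v : 'I_n).

(* The variable x_(a,b) is thought of as an arrow from [b] to [a]: it is, up
   to sign, the function X |-> X b a on m_I. *)
Definition src (k : 'I_#|Defs.coord I|) : 'I_n := (val (enum_val k)).2.
Definition tgt (k : 'I_#|Defs.coord I|) : 'I_n := (val (enum_val k)).1.

Lemma src_tgt k : (chain_index I (src k) < chain_index I (tgt k))%N.
Proof. exact: (valP (enum_val k)). Qed.

(** Degree and torus characters in one family: [D = 1], [phi = 0] gives the degree, [D = 0] the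
    character of the diagonal torus attached to the potential [phi]. *)
Definition edge_weight (D : int) (phi : 'I_n -> int) k : int :=
  D + phi (src k) - phi (tgt k).

Definition edge_homog D phi e p := ihomog (edge_weight D phi) e p.

Definition wtm m v : int := iweight (edge_weight 0 (fun u => (u == v)%:R)) m.

Definition wt p (chi : 'I_n -> int) : Prop :=
  forall m, m \in msupp p -> forall v, wtm m v = chi v.

(** Arrows inside [U] cancel: what is left is the number of arrows leaving [U] minus the number of
    those entering it. *)
Lemma sum_wtm m (U : pred 'I_n) :
  \sum_(v | U v) wtm m v = \sum_k ((U (src k))%:R - (U (tgt k))%:R) *+ m k.
Proof.
have indE a : \sum_(v | U v) (a == v)%:R = (U a)%:R :> int.
  case: (boolP (U a)) => Ua.
    rewrite (bigD1 a) //= eqxx big1 ?addr0 // => v /andP[_ /negPf].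
    by rewrite eq_sym => ->.
  by rewrite big1 // => v Uv; case: eqP => // av; rewrite av Uv in Ua.
rewrite /wtm /iweight exchange_big /=; apply: eq_bigr => k _.
by rewrite sumrMnl /edge_weight sumrB; under eq_bigr do rewrite add0r; rewrite !indE.
Qed.

Lemma wtm_split m v :
  wtm m v = \sum_k ((src k == v)%:R - (tgt k == v)%:R) *+ m k.
Proof. by apply: eq_bigr => k _; rewrite /edge_weight add0r. Qed.

(** If the variable [k] occurred, take for U the vertices in chains of index at least that of
    [tgt k]. Arrows increase the chain index, so none leaves U, while [k] enters it: the total
    weight of U would be negative. *)
Lemma wt0_const p : wt p (fun=> 0) -> p = (p@_0)%:MP.
Proof.
move=> p0.
have supp0 m : m \in msupp p -> m = 0%MM.
  move=> mp; apply/mnmP => k; rewrite mnm0E; apply/eqP; rewrite -leqn0 leqNgt.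
  apply/negP => mk.
  have := sum_wtm m (fun v => chain_index I (tgt k) <= chain_index I v)%N.
  rewrite big1 => [|v _]; last exact: p0.
  move=> /esym/eqP; rewrite lt_eqF //.
  rewrite (bigD1 k) //= leqnn leqNgt (src_tgt k) /= sub0r.
  apply: (@le_lt_trans _ _ (- 1%:R *+ m k)); last first.
    by rewrite mulNrn oppr_lt0 mulrn_wgt0.
  rewrite gerDl sumr_le0 // => j _; rewrite mulrn_wle0 // subr_le0 ler_nat.
  by have := src_tgt j; case: leqP; case: leqP => //; lia.
apply/mpolyP => m; rewrite mcoeffC; case: (boolP (m \in msupp p)) => [/supp0->|].
  by rewrite eqxx mulr1.
case: eqP => [->|_]; first by rewrite mulr1.
by move/memN_msupp_eq0->; rewrite mulr0.
Qed.

Lemma wt_uniq p chi psi : p != 0 -> wt p chi -> wt p psi -> chi =1 psi.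
Proof.
by move=> p0 hchi hpsi v; rewrite -(hchi _ (mlead_supp p0)) (hpsi _ (mlead_supp p0)).
Qed.

Lemma wtM p q chi psi : wt p chi -> wt q psi -> wt (p * q) (fun v => chi v + psi v).
Proof.
move=> hp hq m /msuppM_le /allpairsP[[m1 m2] /= [/hp hm1 /hq hm2 -> v]].
by rewrite /wtm iweightD -/(wtm _ _) hm1 -/(wtm _ _) hm2.
Qed.

(** [whomog_factor] needs natural weights, whereas the weight of a variable at [v] is -1, 0 or 1.
    Adding the degree shifts it to [wv], with values 0, 1, 2, and homogeneity in degree allows the
    shift to be undone. *)
Lemma wt_factor p q e chi :
  p * q != 0 -> edge_homog 1 (fun=> 0) e (p * q) -> wt (p * q) chi ->
  exists psi, wt p psi.
Proof.
move=> pq0 degpq wtpq.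
have degE m : iweight (edge_weight 1 (fun=> 0)) m = (mweight (fun=> 1%N) m)%:Z.
  rewrite -iweight_nat; apply: eq_bigr => k _.
  by rewrite /edge_weight addr0 subr0.
pose wv v k : nat := ((src k == v) + (tgt k != v))%N.
have wvE m v : (mweight (wv v) m)%:Z = (mweight (fun=> 1%N) m)%:Z + wtm m v.
  rewrite -!iweight_nat /wtm /iweight -big_split; apply: eq_bigr => k _ /=.
  by rewrite -mulrnDl /edge_weight /wv; do 2!case: (_ == v).
have mpq := mlead_supp pq0.
have [|d pd] := whomog_factor (w := fun=> 1%N) (d := absz e) pq0.
  by move=> m' m'pq; rewrite -(degpq _ m'pq) degE absz_nat.
exists (wtm (mlead p)) => m mp v.
have [|dv pdv] := whomog_factor (w := wv v) (d := absz (e + chi v)) pq0.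
  move=> m' m'pq; rewrite -[LHS]absz_nat; congr absz.
  by rewrite wvE -degE (degpq _ m'pq) (wtpq _ m'pq).
have p0 : p != 0 by apply: contraNneq pq0 => ->; rewrite mul0r.
have := wvE m v; have := wvE (mlead p) v.
by rewrite !(pd, pdv) ?mlead_supp //; move=> -> /addrI.
Qed.

End NilradWeights.

(** * Common divisors of minors *)

Section MinorsUpToSign.
Variables (A : comNzRingType) (n p : nat) (M : 'M[A]_n).

Lemma injective_sort (f : 'I_p -> 'I_n) : injective f ->
  exists s : 'S_p, {homo f \o s : i j / (i < j)%N}.
Proof.
move=> finj; pose t := [tuple f i | i < p].
pose le := relpre (@nat_of_ord n) leq; pose u := sort_tuple le t.
have /tuple_permP[s us] : perm_eq u t by rewrite /= perm_sort.
exists s => i j ij /=.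
have nthu (k : 'I_p) d : nth d u k = f (s k).
  rewrite us (nth_map k) ?size_enum_ord // nth_ord_enum.
  by rewrite tnth_mktuple.
have uu : uniq u by rewrite sort_uniq map_inj_uniq ?enum_uniq.
have so : sorted le u by apply: sort_sorted => x y; apply: leq_total.
have letr : transitive le by move=> y x z; apply: leq_trans.
have := @sorted_leq_nth _ le letr (fun x => leqnn x) (f (s i)) u so i j.
rewrite !inE size_tuple !ltn_ord (ltnW ij) !nthu => /(_ isT isT isT).
rewrite /= leq_eqVlt => /orP[/eqP/val_inj/finj/perm_inj ijE|//].
by rewrite ijE ltnn in ij.
Qed.

Lemma minor_sign (f g : 'I_p -> 'I_n) (s t : 'S_p) :
  \det (mxsub f g M) =
    (-1) ^+ s * (-1) ^+ t * \det (mxsub (f \o s) (g \o t) M).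
Proof.
have -> : mxsub (f \o s) (g \o t) M = row_perm s (col_perm t (mxsub f g M)).
  by apply/matrixP => i j; rewrite !mxE.
rewrite row_permE col_permE !det_mulmx !det_perm odd_permV.
by case: (odd_perm s) (odd_perm t) => [] [] /=; ring.
Qed.

Lemma minor_noninj_row (f g : 'I_p -> 'I_n) :
  ~ injective f -> \det (mxsub f g M) = 0.
Proof.
move=> /injectiveP/injectivePn[i [j ij fij]].
by apply: (determinant_alternate ij) => k; rewrite !mxE fij.
Qed.

Lemma minor_noninj_col (f g : 'I_p -> 'I_n) :
  ~ injective g -> \det (mxsub f g M) = 0.
Proof.
move=> /injectiveP/injectivePn[i [j ij gij]].
by rewrite -det_tr; apply: (determinant_alternate ij) => k; rewrite !mxE gij.
Qed.

(** Arbitrary index maps, where [nonzero_minor] has increasing ones: sorting changes only a sign and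
    repetitions give 0. In this form the condition passes directly to products of matrices. *)
Definition divides_minors (h : A) : Prop :=
  forall f g : 'I_p -> 'I_n, divides h (\det (mxsub f g M)).

Lemma divides_minorsP h :
  (forall d, nonzero_minor p M d -> divides h d) <-> divides_minors h.
Proof.
split=> [hd f g|hd d [_ [f [g [_ _ ->]]]]]; last exact: hd.
have d0 : divides h 0 by exists 0; rewrite mul0r.
case: (boolP (injectiveb f)) => [/injectiveP fi|/injectiveP fNi]; last first.
  by rewrite minor_noninj_row.
case: (boolP (injectiveb g)) => [/injectiveP gi|/injectiveP gNi]; last first.
  by rewrite minor_noninj_col.
have [[s fs] [t gt]] := (injective_sort fi, injective_sort gi).
rewrite (minor_sign f g s t).
have [->|dN0] := eqVneq (\det (mxsub (f \o s) (g \o t) M)) 0.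
  by rewrite mulr0.
have [|q ->] := hd (\det (mxsub (f \o s) (g \o t) M)).
  by split=> //; exists (f \o s), (g \o t).
by exists ((-1) ^+ s * (-1) ^+ t * q); rewrite mulrA.
Qed.

Lemma divides_minors_factor (h q : A) : divides_minors (h * q) -> divides_minors h.
Proof. by move=> hq f g; have [u ->] := hq f g; exists (u * q); rewrite -mulrA (mulrC q). Qed.

End MinorsUpToSign.

Section NilradMinors.
Variables (F : fieldType) (n : nat) (I : {set 'I_n.-1}).
Implicit Types (p q g : S_nilrad F I) (X : 'M[F]_n).

Lemma M_nilrad_homog D phi a b :
  edge_homog D phi (D + phi b - phi a) (M_nilrad F I a b).
Proof.
rewrite mxE; case: insubP => [u _ uE|_]; last exact: ihomog0.
have -> : D + phi b - phi a = edge_weight D phi (enum_rank u).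
  by rewrite /edge_weight /src /tgt enum_rankK uE.
exact: ihomogX.
Qed.

Lemma M_nilrad_exp_homog D phi k a b :
  edge_homog D phi (D *+ k + phi b - phi a) ((M_nilrad F I ^+ k) a b).
Proof.
elim: k a => [|k IHk] a.
  rewrite expr0 [X in edge_homog _ _ _ X]mxE mulr0n add0r.
  have [->|_] := eqVneq a b; last exact: ihomog0.
  by rewrite subrr -mpolyC1; apply: ihomogC.
rewrite exprS [X in edge_homog _ _ _ X]mxE; apply: ihomog_sum => j _.
have -> : D *+ k.+1 + phi b - phi a
    = (D + phi j - phi a) + (D *+ k + phi b - phi j).
  by rewrite mulrS; ring.
apply: ihomogM; [|exact: IHk]; exact: M_nilrad_homog.
Qed.

(** The potentials telescope along a product of entries, so every term of the Leibniz formula has a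
    weight that depends on the sets of rows and columns only. *)
Lemma minor_homog D phi k h (f' g' : 'I_h -> 'I_n) :
  edge_homog D phi (\sum_i (D *+ k + phi (g' i) - phi (f' i)))
    (\det (mxsub f' g' (M_nilrad F I ^+ k))).
Proof.
apply: ihomog_sum => s _; rewrite -[X in ihomog _ X _]add0r.
apply: ihomogM.
  by rewrite -mpolyC1 -mpolyCN -rmorphXn /=; apply: ihomogC.
have -> : \sum_i (D *+ k + phi (g' i) - phi (f' i))
    = \sum_i (D *+ k + phi (g' (s i)) - phi (f' i)).
  rewrite !sumrB !big_split /=; congr (_ + _ - _).
  exact: (reindex_inj (@perm_inj _ s)).
apply: ihomog_prod => i; rewrite mxE; exact: M_nilrad_exp_homog.
Qed.

Lemma wt_minor k h (f' g' : 'I_h -> 'I_n) :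
  wt (\det (mxsub f' g' (M_nilrad F I ^+ k)))
    (fun v => \sum_i ((g' i == v)%:R - (f' i == v)%:R)).
Proof.
move=> m mp v; rewrite /wtm (minor_homog _ _ mp).
by apply: eq_bigr => i _; rewrite mul0rn add0r.
Qed.

Lemma divides_minors_wt k h g (f' g' : 'I_h -> 'I_n) :
  divides_minors h (M_nilrad F I ^+ k) g ->
  \det (mxsub f' g' (M_nilrad F I ^+ k)) != 0 ->
  exists chi, wt g chi.
Proof.
move=> gd dN0; have [q dE] := gd f' g'.
apply: (@wt_factor _ _ _ g q); rewrite mulrC -dE //; first exact: minor_homog.
exact: wt_minor.
Qed.

(** The bridge from values to weights: all arrows of the monomial found lie in the support of [X],
    read as a directed graph. *)
Lemma eval_nilrad_monomial X p : eval_nilrad X p != 0 ->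
  exists2 m, m \in msupp p &
    forall k, (0 < m k)%N -> X (src k) (tgt k) != 0.
Proof.
pose ok (m : 'X_{1..#|Defs.coord I|}) :=
  [forall k, (0 < m k)%N ==> (X (src k) (tgt k) != 0)].
have [/hasP[m mp /forallP hm] _|/hasPn Nok /eqP[]] := boolP (has ok (msupp p)).
  by exists m => // k; apply/implyP.
rewrite /eval_nilrad mevalE big1_seq // => m /andP[_ /Nok/forallPn[k]].
rewrite negb_imply negbK => /andP[mk /eqP Xk].
by rewrite (bigD1 k) //= -/(tgt k) -/(src k) Xk oppr0 expr0n gtn_eqF //= mul0r mulr0.
Qed.

(** No arrow in the support of [X] enters [U] from outside, so in a monomial that survives at [X]
    only arrows leaving [U] contribute. *)
Lemma wt_exit_ge0 X p chi (U : pred 'I_n) :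
  wt p chi -> eval_nilrad X p != 0 ->
  (forall u v, X u v != 0 -> U v -> U u) ->
  0 <= \sum_(v | U v) chi v.
Proof.
move=> wtp /eval_nilrad_monomial[m mp mX] UX.
rewrite -(eq_bigr _ (fun v _ => wtp m mp v)) sum_wtm sumr_ge0 // => k _.
have [->|mk] := posnP (m k); first by rewrite mulr0n.
rewrite mulrn_wge0 // subr_ge0 ler_nat.
by have := UX _ _ (mX k mk); case: (U (tgt k)) => // ->.
Qed.

Lemma wt_closed_eq0 X p chi (U : pred 'I_n) :
  wt p chi -> eval_nilrad X p != 0 ->
  (forall u v, X u v != 0 -> U u = U v) ->
  \sum_(v | U v) chi v = 0.
Proof.
move=> wtp /eval_nilrad_monomial[m mp mX] UX.
rewrite -(eq_bigr _ (fun v _ => wtp m mp v)) sum_wtm big1 // => k _.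
have [->|mk] := posnP (m k); first by rewrite mulr0n.
by rewrite (UX _ _ (mX k mk)) subrr mul0rn.
Qed.

(** Arrows increase the chain index, so none ends in the first chain. *)
Lemma wt_first_chain_ge0 p chi v :
  p != 0 -> wt p chi -> chain_index I v = 0%N -> 0 <= chi v.
Proof.
move=> p0 wtp v0; rewrite -(wtp _ (mlead_supp p0)) wtm_split sumr_ge0 // => k _.
rewrite mulrn_wge0 // subr_ge0 ler_nat.
have := src_tgt k; case: (tgt k =P v) => [->|//].
by rewrite v0.
Qed.

End NilradMinors.

(** * Lines and the adjoint action of the Borel group *)

Section PolynomialLines.
Variable F : numFieldType.

(** Multiplying by the monic polynomial with roots [bad] removes the exceptions, and the integers
    supply as many distinct roots as desired. *)
Lemma poly_eq0_cofinite (q : {poly F}) (bad : seq F) :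
  (forall t, t \notin bad -> q.[t] = 0) -> q = 0.
Proof.
move=> hq; pose q' := q * \prod_(b <- bad) ('X - b%:P).
have P0 : \prod_(b <- bad) ('X - b%:P) != 0 :> {poly F}.
  by rewrite prodf_seq_neq0; apply/allP => b _; rewrite polyXsubC_eq0.
suff /eqP : q' = 0 by rewrite mulf_eq0 (negPf P0) orbF => /eqP.
apply: (@roots_geq_poly_eq0 _ _ [seq i%:R | i <- iota 0 (size q')]); last first.
- by rewrite size_map size_iota.
- by rewrite map_inj_uniq ?iota_uniq // => i j /eqP; rewrite eqr_nat => /eqP.
apply/allP => _ /mapP[i _ ->]; rewrite /root hornerM horner_prod mulf_eq0.
have [ib|/hq->] := boolP (i%:R \in bad); last by rewrite eqxx.
by rewrite (big_rem _ ib) /= hornerXsubC subrr mul0r eqxx orbT.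
Qed.

Lemma meval_line N (p : {mpoly F[N]}) (a d : 'I_N -> F) :
  exists q : {poly F}, forall t, q.[t] = p.@[fun k => a k + t * d k].
Proof.
exists (\sum_(m <- msupp p) (p@_m)%:P * \prod_k ((a k)%:P + d k *: 'X) ^+ m k).
move=> t; rewrite mevalE horner_sum; apply: eq_bigr => m _.
rewrite hornerM hornerC horner_prod; congr (_ * _); apply: eq_bigr => k _.
by rewrite horner_exp hornerD hornerC hornerZ hornerX mulrC.
Qed.

Definition mxeval n (p : {mpoly F[n * n]}) (X : 'M[F]_n) : F :=
  p.@[fun k => mxvec X 0 k].

(** Takes the place of density of an open set: a generic perturbation of [A] along a single
    direction [D] suffices. *)
Lemma mxeval_line_eq0 n (p : {mpoly F[n * n]}) (A D : 'M[F]_n) (bad : seq F) :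
  (forall t, t \notin bad -> mxeval p (A + t *: D) = 0) -> mxeval p A = 0.
Proof.
move=> h; have [q qE] := meval_line p (mxvec A 0) (mxvec D 0).
have qE' t : q.[t] = mxeval p (A + t *: D).
  by rewrite qE; apply: meval_eq => k; rewrite linearD linearZ !mxE.
suff q0 : q = 0 by rewrite -[A]addr0 -(scale0r D) -qE' q0 horner0.
by apply: (@poly_eq0_cofinite _ bad) => t tb; rewrite qE' h.
Qed.

End PolynomialLines.

Section MinorsOfProducts.
Variables (A : comNzRingType) (n p : nat).
Implicit Types (P N : 'M[A]_n) (h : A).

(** Cauchy-Binet as the expansion by multilinearity in the rows, summed over all index maps instead
    of increasing ones. *)
Lemma det_mxsub_mull P N (f g : 'I_p -> 'I_n) :
  \det (mxsub f g (P *m N)) =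
    \sum_(u : {ffun 'I_p -> 'I_n}) (\prod_i P (f i) (u i)) * \det (mxsub u g N).
Proof.
rewrite /determinant; under eq_bigr => s _.
  under eq_bigr => i _ do rewrite !mxE.
  rewrite bigA_distr_bigA mulr_sumr /=.
  over.
rewrite exchange_big /=; apply: eq_bigr => u _.
rewrite mulr_sumr; apply: eq_bigr => s _.
rewrite big_split /= mulrCA; congr (_ * (_ * _)).
by apply: eq_bigr => i _; rewrite mxE.
Qed.

Lemma divides_minors_mull h P N :
  divides_minors p N h -> divides_minors p (P *m N) h.
Proof.
move=> hN f g; rewrite det_mxsub_mull.
apply: (big_ind (divides h)) => [|x y [a ->] [b ->]|u _].
- by exists 0; rewrite mul0r.
- by exists (a + b); rewrite mulrDl.
- by have [q ->] := hN u g; exists (\prod_i P (f i) (u i) * q); rewrite mulrA.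
Qed.

Lemma divides_minors_tr h N : divides_minors p N h -> divides_minors p N^T h.
Proof.
move=> hN f g; have [q qE] := hN g f; exists q; rewrite -qE -det_tr.
by congr (\det _); apply/matrixP => i j; rewrite !mxE.
Qed.

Lemma divides_minors_mulr h P N :
  divides_minors p N h -> divides_minors p (N *m P) h.
Proof.
move=> hN; rewrite -[N *m P]trmxK trmx_mul; apply: divides_minors_tr.
by apply: divides_minors_mull; apply: divides_minors_tr.
Qed.

End MinorsOfProducts.

Lemma map_divides_minors (A B : comNzRingType) (phi : {rmorphism A -> B}) n p
    (M : 'M[A]_n) h :
  divides_minors p M h -> divides_minors p (map_mx phi M) (phi h).
Proof.
move=> hM f g; have [q qE] := hM f g; exists (phi q).
rewrite -rmorphM -qE -det_map_mx; congr (\det _).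
by apply/matrixP => i j; rewrite !mxE.
Qed.

Lemma trig_inverse (F : fieldType) n (P Q : 'M[F]_n) :
  P *m Q = 1%:M -> is_trig_mx P -> is_trig_mx Q.
Proof.
move=> PQ Ptrig; have Pdiag i : P i i != 0.
  have := mulmx1_unit PQ; rewrite unitmxE det_trig // unitfE => -[+ _].
  by move=> /prodf_neq0 /(_ i isT).
apply/is_trig_mxP => i; have [k ik] := ubnP (val i).
elim: k i ik => // k IHk i ik j ij.
have /matrixP/(_ i j) := PQ; rewrite !mxE lt_eqF //.
rewrite (bigD1 i) //= big1 ?addr0 => [/eqP|u ui].
  by rewrite mulf_eq0 (negPf (Pdiag i)) => /eqP.
have [iu|ui'] := ltnP i u; first by rewrite (is_trig_mxP Ptrig) ?mul0r.
have {}ui' : (u < i)%N by rewrite ltn_neqAle ui' andbT.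
by rewrite IHk ?mulr0 //; [apply: leq_trans ui' ik | apply: ltn_trans ui' ij].
Qed.

(** * The adjoint action on S(m_I^-) *)

Section AdjointAction.
Variables (F : fieldType) (n : nat) (I : {set 'I_n.-1}).
Implicit Types (p q g : S_nilrad F I) (X Y : 'M[F]_n).

Lemma chain_index_mono (a b : 'I_n) : (a <= b)%N -> (chain_index I a <= chain_index I b)%N.
Proof.
move=> ab; apply: subset_leq_card; apply/fintype.subsetP => i; rewrite !inE.
by move=> /andP[/leq_trans->].
Qed.

Definition in_m X : Prop := forall a b, X a b != 0 -> in_nilrad I a b.

Definition conj_poly (P Q : 'M[F]_n) : 'M[S_nilrad F I]_n :=
  map_mx (@mpolyC _ F) P *m M_nilrad F I *m map_mx (@mpolyC _ F) Q.

(* For [P = (b^-1)^T] and [Q = b^T] this is composition with the adjoint action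
   of [b], see [eval_adjoint]. *)
Definition adjoint (P Q : 'M[F]_n) (p : S_nilrad F I) : S_nilrad F I :=
  comp_mpoly [tuple conj_poly P Q (tgt k) (src k) | k < #|Defs.coord I|] p.

HB.instance Definition _ P Q := GRing.RMorphism.copy (adjoint P Q)
  (comp_mpoly [tuple conj_poly P Q (tgt k) (src k) | k < #|Defs.coord I|]).

Lemma conj_poly_nilrad P Q a b : is_trig_mx P -> is_trig_mx Q ->
  ~~ in_nilrad I b a -> conj_poly P Q a b = 0.
Proof.
move=> /is_trig_mxP Pt /is_trig_mxP Qt ab; rewrite mxE big1 // => j _.
rewrite [map_mx _ Q _ _]mxE.
have [jb|bj] := ltnP j b; first by rewrite Qt // mpolyC0 mulr0.
rewrite mxE big1 ?mul0r // => i _; rewrite !mxE.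
have [ai|ia] := ltnP a i; first by rewrite Pt // mpolyC0 mul0r.
case: insubP => [u /= ij _|_]; last by rewrite mulr0.
case/negP: ab; rewrite /in_nilrad (leq_ltn_trans (chain_index_mono bj)) //.
exact: leq_trans ij (chain_index_mono ia).
Qed.

Lemma adjointE P Q p : adjoint P Q p =
  \sum_(m <- msupp p) p@_m *: \prod_k conj_poly P Q (tgt k) (src k) ^+ m k.
Proof.
rewrite /adjoint comp_mpolyEX; apply: eq_bigr => m _.
rewrite comp_mpolyX; congr (_ *: _); apply: eq_bigr => k _.
by rewrite tnth_mktuple.
Qed.

Lemma map_adjoint_M P Q : is_trig_mx P -> is_trig_mx Q ->
  map_mx (adjoint P Q) (M_nilrad F I) = conj_poly P Q.
Proof.
move=> Pt Qt; apply/matrixP => a b; rewrite [LHS]mxE [in LHS]mxE.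
case: insubP => [u _ uE|abN].
  rewrite /adjoint comp_mpolyXU -tnth_nth tnth_mktuple.
  by rewrite /src /tgt enum_rankK uE.
by rewrite conj_poly_nilrad // raddf0.
Qed.

Lemma map_adjoint_C P Q (A : 'M[F]_n) :
  map_mx (adjoint P Q) (map_mx (@mpolyC _ F) A) = map_mx (@mpolyC _ F) A.
Proof. by apply/matrixP => a b; rewrite !mxE /adjoint comp_mpolyC. Qed.

(** The action replaces the generic matrix by a conjugate under scalar matrices. By Cauchy-Binet the
    minors of a power and those of its conjugate are combinations of each other, hence have the same
    common divisors. *)
Lemma divides_minors_adjoint P Q k h g : P *m Q = 1%:M ->
  is_trig_mx P -> is_trig_mx Q ->
  divides_minors h (M_nilrad F I ^+ k) g ->
  divides_minors h (M_nilrad F I ^+ k) (adjoint P Q g).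
Proof.
move=> PQ Pt Qt gd; have QP := mulmx1C PQ.
pose C := @map_mx _ _ (@mpolyC #|Defs.coord I| F) n n.
have CPQ : C P *m C Q = 1%:M by rewrite -map_mxM PQ map_mx1.
have CQP : C Q *m C P = 1%:M by rewrite -map_mxM QP map_mx1.
have ME : map_mx (adjoint P Q) (M_nilrad F I ^+ k) = C P *m (M_nilrad F I ^+ k) *m C Q.
  elim: k {gd} => [|k IHk]; first by rewrite !expr0 map_mx1 mulmx1.
  rewrite !exprS -!mulmxE map_mxM IHk map_adjoint_M // /conj_poly -/(C P) -/(C Q).
  by rewrite !mulmxA -[_ *m C Q *m C P]mulmxA CQP mulmx1.
have -> : M_nilrad F I ^+ k = C Q *m map_mx (adjoint P Q) (M_nilrad F I ^+ k) *m C P.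
  by rewrite ME !mulmxA CQP mul1mx -mulmxA CQP mulmx1.
apply: divides_minors_mulr; apply: divides_minors_mull.
exact: map_divides_minors.
Qed.

Lemma adjointK P Q : P *m Q = 1%:M -> is_trig_mx P -> is_trig_mx Q ->
  cancel (adjoint P Q) (adjoint Q P).
Proof.
move=> PQ Pt Qt g; have QP := mulmx1C PQ.
have ME : map_mx (adjoint Q P) (conj_poly P Q) = M_nilrad F I.
  rewrite /conj_poly !map_mxM !map_adjoint_C map_adjoint_M // /conj_poly.
  rewrite !mulmxA -map_mxM PQ map_mx1 mul1mx -mulmxA -map_mxM PQ map_mx1.
  by rewrite mulmx1.
rewrite (adjointE P Q) rmorph_sum [RHS]mpolyE; apply: eq_bigr => m _.
rewrite [LHS]comp_mpolyZ -/(adjoint Q P _) rmorph_prod [in RHS]mpolyXE_id.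
congr (_ *: _); apply: eq_bigr => k _.
rewrite rmorphXn; congr (_ ^+ _).
have /matrixP/(_ (tgt k) (src k)) := ME; rewrite [LHS]mxE => E; apply: etrans E _.
rewrite mxE insubT => [|lt_k]; first exact: src_tgt.
congr 'X__; apply/enum_val_inj; rewrite enum_rankK.
by apply/val_inj => /=; rewrite -surjective_pairing.
Qed.

HB.instance Definition _ X := GRing.RMorphism.copy (@eval_nilrad F n I X)
  (meval (fun k => - X (src k) (tgt k))).

Lemma eval_M_nilrad X : in_m X ->
  map_mx (@eval_nilrad F n I X) (M_nilrad F I) = - X^T.
Proof.
move=> Xm; apply/matrixP => a b; rewrite !mxE.
case: insubP => [u _ uE|abN]; first by rewrite /eval_nilrad mevalXU enum_rankK uE.
rewrite /eval_nilrad meval0; have [->|/Xm] := eqVneq (X b a) 0; first by rewrite oppr0.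
by move=> ba; rewrite /= ba in abN.
Qed.

Lemma eval_adjoint X P Q g : in_m X ->
  eval_nilrad X (adjoint P Q g) = eval_nilrad (Q^T *m X *m P^T) g.
Proof.
move=> Xm; rewrite /eval_nilrad /adjoint comp_mpoly_meval; apply: meval_eq => k.
rewrite tnth_mktuple.
have /matrixP/(_ (tgt k) (src k)) : map_mx (@eval_nilrad F n I X) (conj_poly P Q)
    = - (Q^T *m X *m P^T)^T.
  rewrite /conj_poly !map_mxM eval_M_nilrad // !trmx_mul !trmxK.
  have CE A : map_mx (@eval_nilrad F n I X) (map_mx (@mpolyC _ F) A) = A.
    by apply/matrixP => a b; rewrite !mxE /eval_nilrad mevalC.
  by rewrite !CE mulmxN mulNmx mulmxA.
by rewrite [in LHS]mxE [in RHS]mxE [in RHS]mxE.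
Qed.

End AdjointAction.

(** * Path systems *)

Section Rank.
Variables (T : finType) (key : T -> nat) (A : {set T}).
Implicit Types u v : T.

(** The position of [v] in [A] sorted by [key], counted from 0. It serves for positions in chains,
    along paths and in the rows of a tableau. *)
Definition rank v : nat := #|[set u in A | (key u < key v)%N]|.

Lemma rank_lt u v : u \in A -> (key u < key v)%N -> (rank u < rank v)%N.
Proof.
move=> uA uv; apply: proper_card; apply/properP; split.
  apply/fintype.subsetP => w; rewrite !inE => /andP[-> /=].
  by move=> /ltn_trans->.
by exists u; rewrite !inE uA //= ltnn.
Qed.

Lemma rank_bound v : v \in A -> (rank v < #|A|)%N.
Proof.
move=> vA; apply: proper_card; apply/properP; split.
  by apply/fintype.subsetP => w; rewrite !inE => /andP[].
by exists v; rewrite // !inE ltnn andbF.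
Qed.

Hypothesis key_inj : {in A &, injective key}.

Lemma rank_inj : {in A &, injective rank}.
Proof.
move=> u v uA vA uv; apply: key_inj => //; apply/eqP.
by case: ltngtP => // [/(rank_lt uA)|/(rank_lt vA)]; rewrite uv ltnn.
Qed.

Lemma rank_ltE u v : u \in A -> v \in A -> (rank u < rank v)%N = (key u < key v)%N.
Proof.
move=> uA vA; apply/idP/idP; last exact: rank_lt.
apply: contraLR; rewrite -2!leqNgt leq_eqVlt => /orP[/eqP/(key_inj vA uA)->//|].
by move=> /(rank_lt vA)/ltnW.
Qed.

Lemma rank_onto i : (i < #|A|)%N -> exists2 v, v \in A & rank v = i.
Proof.
move=> iA; pose g v : 'I_#|A| := insubd (Ordinal iA) (rank v).
have gE v : v \in A -> val (g v) = rank v.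
  by move=> vA; rewrite val_insubd rank_bound.
have ginj : {in A &, injective g}.
  by move=> v w vA wA /(congr1 val); rewrite !gE //; apply: rank_inj.
have : Ordinal iA \in g @: A.
  suff -> : g @: A = [set: _] by rewrite inE.
  by apply/eqP; rewrite eqEcard finset.subsetT cardsT card_ord card_in_imset /=.
by case/imsetP => v vA /(congr1 val); rewrite gE // => /= iv; exists v.
Qed.

Lemma card_rank_eq i : #|[set v in A | rank v == i]| = (i < #|A|)%N.
Proof.
case: ltnP => [/rank_onto[v vA vi]|Ai].
  suff -> : [set w in A | rank w == i] = [set v] by rewrite cards1.
  apply/setP => w; rewrite !inE; apply/andP/eqP => [[wA /eqP wi]|->].
    by apply: rank_inj; rewrite // wi.
  by rewrite vA vi.
apply/eqP; rewrite cards_eq0; apply/eqP/setP => v; rewrite !inE.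
by apply/negP => /andP[/rank_bound + /eqP vi]; rewrite vi ltnNge Ai.
Qed.

Lemma card_rank_lt c : #|[set v in A | (rank v < c)%N]| = minn c #|A|.
Proof.
elim: c => [|c IHc].
  by rewrite min0n; apply/eqP; rewrite cards_eq0; apply/eqP/setP => v; rewrite !inE ltn0 andbF.
have -> : [set v in A | (rank v < c.+1)%N]
    = [set v in A | (rank v < c)%N] :|: [set v in A | rank v == c].
  by apply/setP => v; rewrite !inE -andb_orr ltnS leq_eqVlt orbC.
rewrite cardsU IHc card_rank_eq.
suff -> : [set v in A | (rank v < c)%N] :&: [set v in A | rank v == c] = finset.set0.
  by rewrite cards0 subn0; lia.
apply/setP => v; rewrite !inE; apply/negP => /andP[/andP[_ vc] /andP[_ /eqP vE]].
by rewrite vE ltnn in vc.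
Qed.

End Rank.

Section PathSystems.
Variables (n : nat) (key rho : 'I_n -> nat).
Hypothesis rho_inj : forall u v, key u = key v -> rho u = rho v -> u = v.

(** The fibers of [rho] are the paths, each ordered by [key]. The key is the chain index when the
    path matrix has to lie in m_I, and the vertex itself when the paths are the rows of a
    tableau. *)
Definition fiber (u : 'I_n) : {set 'I_n} := [set v | rho v == rho u].

Definition path_pos (u : 'I_n) : nat := rank (key) (fiber u) u.

Lemma fiber_eq u v : rho u = rho v -> fiber u = fiber v.
Proof. by move=> uv; apply/setP => w; rewrite !inE uv. Qed.

Lemma key_inj_fiber u : {in fiber u &, injective (key)}.
Proof.
by move=> v w; rewrite !inE => /eqP vu /eqP wu /rho_inj; apply; rewrite vu wu.
Qed.

Lemma path_pos_ltE u v : rho u = rho v ->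
  (path_pos u < path_pos v)%N = (key u < key v)%N.
Proof.
move=> uv; rewrite /path_pos (fiber_eq uv) rank_ltE ?inE ?uv //.
exact: key_inj_fiber.
Qed.

Lemma path_pos_inj u v : rho u = rho v -> path_pos u = path_pos v -> u = v.
Proof.
move=> uv; rewrite /path_pos (fiber_eq uv).
by apply: rank_inj; rewrite ?inE ?uv //; apply: key_inj_fiber.
Qed.

Lemma path_pos_bound u : (path_pos u < #|fiber u|)%N.
Proof. by apply: rank_bound; rewrite inE. Qed.

Lemma path_pos_onto u i : (i < #|fiber u|)%N ->
  exists2 v, rho v = rho u & path_pos v = i.
Proof.
move=> /(rank_onto (@key_inj_fiber u))[v]; rewrite inE => /eqP vu <-.
by exists v; rewrite // /path_pos (fiber_eq vu).
Qed.

Variable F : fieldType.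

Definition path_step k (u v : 'I_n) : bool :=
  (rho u == rho v) && (path_pos v == path_pos u + k)%N.

Definition path_mx : 'M[F]_n := \matrix_(u, v) (path_step 1 u v)%:R.

Lemma path_mx_exp k u v : (path_mx ^+ k) u v = (path_step k u v)%:R.
Proof.
elim: k u => [|k IHk] u.
  rewrite expr0 mxE /path_step addn0; congr (nat_of_bool _)%:R.
  apply/eqP/andP => [->|[/eqP uv /eqP/esym]]; first by rewrite !eqxx.
  exact: path_pos_inj.
rewrite exprS mxE; under eq_bigr do rewrite IHk mxE -natrM mulnb.
case: (boolP (path_step k.+1 u v)) => [/andP[/eqP uv /eqP puv]|uvN].
  have [|w wv pw] := @path_pos_onto v (path_pos u).+1.
    by rewrite (leq_ltn_trans _ (path_pos_bound v)) // puv addnS ltnS leq_addr.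
  rewrite (bigD1 w) //= big1 => [|w' w'w].
    by rewrite /path_step wv uv !eqxx pw puv addn1 eqxx addnS addSn eqxx addr0.
  case: (boolP (path_step 1 u w')) => //= /andP[/eqP uw' /eqP pw'].
  case/eqP: w'w; apply: path_pos_inj; first by rewrite -uw' uv wv.
  by rewrite pw' pw addn1.
rewrite big1 // => w _; case: andP => // -[/andP[/eqP uw /eqP pw] /andP[/eqP wv /eqP pv]].
by case/negP: uvN; rewrite /path_step uw wv pv pw addn1 addnS addSn !eqxx.
Qed.

(** Each of the paths with label below [c] has at most [k] vertices without a vertex [k] steps
    further on. At least [h] vertices remain; these as rows and their [k]-step successors as columns
    give an identity matrix. *)
Lemma path_minor (c k h : nat) :
  (h + c * k <= #|[set u | rho u < c]|)%N ->
  exists f g : 'I_h -> 'I_n, \det (mxsub f g (path_mx ^+ k)) = 1.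
Proof.
move=> hk; pose S := [set u | (rho u < c)%N & [exists v, path_step k u v]].
have cardS : (h <= #|S|)%N.
  pose U := [set u | (rho u < c)%N] :\: S.
  suff cardU : (#|U| <= c * k)%N.
    have := cardsID S [set u | (rho u < c)%N]; rewrite -/U.
    have := subset_leq_card (subsetIr [set u | (rho u < c)%N] S).
    by move: hk cardU; lia.
  have [->|[u0 u0U]] := set_0Vmem U; first by rewrite cards0.
  have UP u : u \in U -> (rho u < c)%N /\ (#|fiber u| <= path_pos u + k)%N.
    rewrite !inE => /andP[+ uc]; rewrite uc /= negb_exists => /forallP uN.
    split=> //; rewrite leqNgt; apply/negP => /path_pos_onto[v vu pv].
    by have := uN v; rewrite /path_step vu pv !eqxx.
  have [u0c u0k] := UP _ u0U.
  have k0 : (#|fiber u0|.-1 - path_pos u0 < k)%N.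
    by have := path_pos_bound u0; move: u0k; lia.
  (* A vertex of [U] is determined by its path and its distance from the end of the path, which is
     less than [k]. The vertex [u0] provides the defaults, which are not reached on [U]. *)
  pose g (u : 'I_n) : 'I_c * 'I_k :=
    (insubd (Ordinal u0c) (rho u), insubd (Ordinal k0) (#|fiber u|.-1 - path_pos u)%N).
  rewrite -[c]card_ord -[k]card_ord -card_prod -cardsT.
  have ginj : {in U &, injective g}.
    move=> u v /UP[uc uk] /UP[vc vk] [/(congr1 val) + /(congr1 val)].
    rewrite !val_insubd uc vc => uv.
    have bu := path_pos_bound u; have bv := path_pos_bound v.
    move: uk bu; rewrite (fiber_eq uv) => uk bu.
    have -> : (#|fiber v|.-1 - path_pos u < k)%N. by move: uk bu; lia.
    have -> : (#|fiber v|.-1 - path_pos v < k)%N by move: vk bv; lia.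
    have subI a b z : (a < z -> b < z -> z.-1 - a = z.-1 - b -> a = b)%N by lia.
    by move=> /= /(subI _ _ _ bu bv); apply: path_pos_inj.
  rewrite -(card_in_imset ginj); exact/subset_leq_card/finset.subsetT.
pose f (i : 'I_h) : 'I_n := enum_val (widen_ord cardS i).
have fS i : f i \in S by apply: enum_valP.
have finj : injective f by move=> i j /enum_val_inj/(congr1 val)/= /val_inj.
have gex i : exists v, path_step k (f i) v.
  by have := fS i; rewrite inE => /andP[_ /existsP].
exists f, (fun i => xchoose (gex i)); rewrite -[RHS](det1 _ h); congr (\det _).
apply/matrixP => i j; rewrite [RHS]mxE mxE path_mx_exp.
have := xchooseP (gex j); rewrite /path_step.
set w := xchoose _ => /andP[/eqP jw /eqP pw].
congr (nat_of_bool _)%:R; apply/idP/eqP => [|->]; last by rewrite jw pw !eqxx.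
move=> /andP[/eqP iw]; rewrite pw => /eqP /addIn pij.
by apply: finj; apply: path_pos_inj; [rewrite iw jw | rewrite pij].
Qed.

End PathSystems.

Section ChainPaths.
Variables (F : fieldType) (n : nat) (I : {set 'I_n.-1}).

(** Evaluation transposes the matrix, whence the exchange of [f] and [g], and produces a sign, which
    a comparison with 0 ignores. *)
Lemma eval_minor k h (f g : 'I_h -> 'I_n) (X : 'M[F]_n) : in_m I X ->
  (eval_nilrad X (\det (mxsub f g (M_nilrad F I ^+ k))) == 0)
    = (\det (mxsub g f (X ^+ k)) == 0).
Proof.
move=> Xm.
have powE : map_mx (@eval_nilrad F n I X) (M_nilrad F I ^+ k)
    = (-1) ^+ k *: (X ^+ k)^T.
  elim: k => [|k IHk]; first by rewrite !expr0 map_mx1 trmx1 scale1r.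
  rewrite exprS [X ^+ _]exprSr -!mulmxE map_mxM IHk eval_M_nilrad // exprS.
  by rewrite trmx_mul -scalemxAr mulNmx scalerN mulN1r scaleNr.
rewrite -det_map_mx.
have -> : map_mx (@eval_nilrad F n I X) (mxsub f g (M_nilrad F I ^+ k))
    = (-1) ^+ k *: (mxsub g f (X ^+ k))^T.
  by have /matrixP E := powE; apply/matrixP => i j; have := E (f i) (g j); rewrite !mxE.
by rewrite detZ det_tr mulf_eq0 expf_eq0 signr_eq0 andbF.
Qed.

Variable rho : 'I_n -> nat.
Hypothesis rho_inj : forall u v, chain_index I u = chain_index I v -> rho u = rho v -> u = v.

Lemma path_mx_in_m : in_m I (path_mx (chain_index I) rho F).
Proof.
move=> u v; rewrite mxE; case: (boolP (path_step (chain_index I) rho 1 u v)); rewrite ?eqxx //.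
move=> /andP[/eqP uv /eqP puv] _.
by rewrite /in_nilrad -(path_pos_ltE rho_inj uv) puv addn1.
Qed.

Lemma path_minor_neq0 (c k h : nat) : (h + c * k <= #|[set u | rho u < c]|)%N ->
  exists f g : 'I_h -> 'I_n, \det (mxsub f g (M_nilrad F I ^+ k)) != 0.
Proof.
move=> /(path_minor rho_inj F)[f [g fg]]; exists g, f.
apply: contraNneq (oner_neq0 F) => E; rewrite -fg -eval_minor; last exact: path_mx_in_m.
by rewrite E raddf0.
Qed.

(** Some minor is non-zero at the path matrix, so its divisor [g] is non-zero there too, and no
    arrow of the path matrix crosses from one path to another. *)
Lemma path_wt (c k h : nat) (g : S_nilrad F I) chi i :
  (h + c * k <= #|[set u | rho u < c]|)%N ->
  divides_minors h (M_nilrad F I ^+ k) g -> wt g chi ->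
  \sum_(v | rho v == i) chi v = 0.
Proof.
move=> /(path_minor rho_inj F)[f [f' ff']] gd wtg.
apply: (wt_closed_eq0 (X := path_mx (chain_index I) rho F) wtg) => [|u v].
  apply: contraNneq (oner_neq0 F) => E; rewrite -ff' -eval_minor; last exact: path_mx_in_m.
  by have [q ->] := gd f' f; rewrite rmorphM /= E mulr0.
by rewrite mxE; case: (boolP (path_step (chain_index I) rho 1 u v)); rewrite ?eqxx // => /andP[/eqP->].
Qed.

End ChainPaths.

(** * Weights of the common divisors *)

Section ChainCombinatorics.
Variables (n : nat) (I : {set 'I_n.-1}).
Implicit Types u v : 'I_n.

Lemma chain_index_bound v : (chain_index I v < nchains I)%N.
Proof.
rewrite ltnS; apply: subset_leq_card; apply/fintype.subsetP => i.
by rewrite !inE => /andP[].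
Qed.

Lemma chain_index_first v : val v = 0%N -> chain_index I v = 0%N.
Proof.
move=> v0; apply/eqP; rewrite cards_eq0; apply/eqP/setP => i.
by rewrite !inE v0 ltn0.
Qed.

Lemma chain_index_last v : val v = n.-1 -> chain_index I v = (nchains I).-1.
Proof. by move=> vn; apply: eq_card => i; rewrite !inE vn ltn_ord. Qed.

(** The position in the chain, which is also the row of [v] in T_I. *)
Definition off v : nat := rank (@nat_of_ord n) (chain I (chain_index I v)) v.

Lemma mem_chain v : v \in chain I (chain_index I v).
Proof. by rewrite inE. Qed.

Lemma chainE u v : chain_index I u = chain_index I v -> u \in chain I (chain_index I v).
Proof. by rewrite inE => ->. Qed.

Lemma off_inj u v : chain_index I u = chain_index I v -> off u = off v -> u = v.
Proof.
move=> uv; rewrite /off uv; apply: rank_inj => [? ? _ _ /val_inj//||].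
  exact: chainE.
exact: mem_chain.
Qed.

Lemma off_ltE u v : chain_index I u = chain_index I v -> (off u < off v)%N = (u < v)%N.
Proof.
move=> uv; rewrite /off uv; apply: rank_ltE => [? ? _ _ /val_inj//||].
  exact: chainE.
exact: mem_chain.
Qed.

Lemma off_bound v : (off v < chain_length I (chain_index I v))%N.
Proof. exact/rank_bound/mem_chain. Qed.

Lemma off_onto j k : (k < chain_length I j)%N ->
  exists2 v, chain_index I v = j & off v = k.
Proof.
move=> kj; have [? ? _ _ /val_inj//|v] := @rank_onto _ (@nat_of_ord n) (chain I j) _ k kj.
by rewrite inE => /eqP vj vk; exists v; rewrite // /off vj.
Qed.

Lemma card_off_lt c : #|[set v | (off v < c)%N]|
  = (\sum_(j < nchains I) minn c (chain_length I j))%N.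
Proof.
rewrite -sum1_card.
rewrite (partition_big (fun v => Ordinal (chain_index_bound v)) xpredT) //=.
apply: eq_bigr => j _; rewrite sum1dep_card /chain_length -(@card_rank_lt _ (@nat_of_ord n)); last first.
  by move=> ? ? _ _ /val_inj.
apply: eq_card => v; rewrite !inE -val_eqE /= andbC /off.
by case: eqP => // ->.
Qed.

Lemma nchains_gt1_n : (1 < nchains I)%N -> (1 < n)%N.
Proof.
rewrite ltnS => /(fun h => leq_trans h (max_card _)); rewrite card_ord.
by case: n => [|[]].
Qed.

End ChainCombinatorics.

Section EndChains.
Variables (F : fieldType) (n : nat) (I : {set 'I_n.-1}) (c r s : nat).
Hypothesis chains_ge2 : (2 <= nchains I)%N.
Hypothesis first_c : chain_length I 0 = c.
Hypothesis last_c : chain_length I (nchains I).-1 = c.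
Hypothesis mid_c : forall j, (0 < j)%N -> (j < (nchains I).-1)%N -> chain_length I j <> c.
Hypothesis rE : r = #|[set j : 'I_(nchains I) | (c < chain_length I j)%N]|.
Hypothesis sE : (s + 2 * c)%N
  = (\sum_(j < nchains I | (chain_length I j <= c)%N) chain_length I j)%N.
Implicit Types (u v : 'I_n) (g p q : S_nilrad F I).

Lemma n_gt0 : (0 < n)%N.
Proof. exact/ltnW/(nchains_gt1_n chains_ge2). Qed.

Lemma c_gt0 : (0 < c)%N.
Proof.
rewrite -first_c; apply/card_gt0P; exists (Ordinal n_gt0).
by rewrite inE chain_index_first.
Qed.

(** Chains of length at most c contribute all their s + 2c vertices and each of the r longer ones
    contributes c. The sum is split as [path_minor] wants it for c paths, the power r + 1 and minors
    of size s + c. *)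
Lemma card_off_lt_c : #|[set v | (off I v < c)%N]| = (s + c + c * r.+1)%N.
Proof.
rewrite card_off_lt (bigID (fun j : 'I__ => (chain_length I j <= c)%N)) /=.
under eq_bigr => j jc do rewrite (minn_idPr jc).
rewrite -sE (eq_bigr (fun=> c)) => [|j]; last by rewrite -ltnNge => /ltnW/minn_idPl.
transitivity (s + 2 * c + r * c)%N; last by ring.
rewrite sum_nat_const rE; congr (_ + _ * _)%N.
by apply: eq_card => j; rewrite !inE ltnNge.
Qed.

(* The path system of the first [c] rows of T_I; [c + v] isolates the others. *)
Definition rho0 v : nat := if (off I v < c)%N then off I v else (c + v)%N.

Lemma rho0_ltE v : (rho0 v < c)%N = (off I v < c)%N.
Proof. by rewrite /rho0; case: ifP => // _; rewrite ltnNge leq_addr. Qed.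

Lemma rho0_inj u v : chain_index I u = chain_index I v -> rho0 u = rho0 v -> u = v.
Proof.
move=> uv; rewrite /rho0; case: ltnP => uc; case: ltnP => vc.
- exact: off_inj.
- by move=> E; rewrite E ltnNge leq_addr in uc.
- by move=> E; rewrite -E ltnNge leq_addr in vc.
- by move=> /addnI/val_inj.
Qed.

Lemma card_rho0 : (s + c + c * r.+1 <= #|[set v | (rho0 v < c)%N]|)%N.
Proof.
by rewrite -card_off_lt_c; apply: subset_leq_card; apply/fintype.subsetP => v; rewrite !inE rho0_ltE.
Qed.

Local Notation common_divisor := (divides_minors (s + c) (M_nilrad F I ^+ r.+1)).

(* Exchanging [u] and [v] in [rho0] gives another admissible path system. *)
Lemma wt_chain_const g chi u v : common_divisor g -> wt g chi ->
  chain_index I u = chain_index I v -> chi u = chi v.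
Proof.
move=> gd wtg uv; have [->//|uNv] := eqVneq u v.
have ruv : rho0 v != rho0 u by apply: contra_neq uNv => /rho0_inj->.
pose t := tperm u v.
have chain_t w : chain_index I (t w) = chain_index I w.
  by rewrite /t; case: tpermP => [->|->|].
have h : (s + c + c * r.+1 <= #|[set w | (rho0 (t w) < c)%N]|)%N.
  rewrite (leq_trans card_rho0) // -(card_preimset _ (@perm_inj _ t)).
  by apply: subset_leq_card; apply/fintype.subsetP => w; rewrite !inE.
have rt_inj w w' : chain_index I w = chain_index I w' -> rho0 (t w) = rho0 (t w') -> w = w'.
  by move=> ww' /rho0_inj E; apply: (@perm_inj _ t); apply: E; rewrite !chain_t.
have := path_wt rho0_inj (rho0 u) card_rho0 gd wtg.
have := path_wt rt_inj (rho0 u) h gd wtg.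
rewrite (reindex_inj (@perm_inj _ t)) /= (eq_bigl (fun w => rho0 w == rho0 u)); last first.
  by move=> w; rewrite /t tpermK.
rewrite (bigD1 u) //= [in X in _ -> X -> _](bigD1 u) //= tpermL => e1 e2.
move: (etrans e2 (esym e1)).
rewrite [X in _ = _ + X -> _](eq_bigr chi) => [/addIr//|w /andP[/eqP wu wNu]].
by rewrite tpermD 1?eq_sym //; apply: contra_neq ruv => <-.
Qed.

(* In a chain shorter than [c] a vertex can be moved to the empty row [c.-1] of
   the chain; a longer chain has a vertex which is alone in its fiber of [rho0]. *)
Lemma wt_eq0_mid g chi v : common_divisor g -> wt g chi ->
  chain_length I (chain_index I v) <> c -> chi v = 0.
Proof.
move=> gd wtg vc; case: (ltngtP (chain_length I (chain_index I v)) c) => // [short|long].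
  pose rho1 u := if u == v then c.-1 else rho0 u.
  have offv : (off I v < c.-1)%N by have := off_bound I v; lia.
  have off_short u : chain_index I u = chain_index I v -> (off I u < c.-1)%N.
    by move=> uv; have := off_bound I u; rewrite uv; lia.
  have rho0_short u : chain_index I u = chain_index I v -> rho0 u = off I u.
    by move=> /off_short uc; rewrite /rho0 (leq_trans uc) ?leq_pred.
  have rho1_inj u w : chain_index I u = chain_index I w -> rho1 u = rho1 w -> u = w.
    rewrite /rho1; case: (eqVneq u v) (eqVneq w v) => [->|_] [->|_] // uw.
    - by move=> E; have := off_short w (esym uw); rewrite -(rho0_short w) // -E ltnn.
    - by move=> E; have := off_short u uw; rewrite -(rho0_short u) // E ltnn.
    - exact: rho0_inj.
  have h : (s + c + c * r.+1 <= #|[set w | (rho1 w < c)%N]|)%N.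
    rewrite (leq_trans card_rho0) //; apply: subset_leq_card.
    apply/fintype.subsetP => w; rewrite !inE /rho1.
    by case: ifP => // _ _; rewrite prednK // c_gt0.
  (* Moving [v] takes exactly [v] out of its old path, and the weights along that path sum to 0
     before and after. *)
  have := path_wt rho0_inj (rho0 v) card_rho0 gd wtg.
  have := path_wt rho1_inj (rho0 v) h gd wtg.
  rewrite [in X in _ -> X -> _](bigD1 v) //=.
  rewrite (eq_bigl (fun u => (rho0 u == rho0 v) && (u != v))) => [-> |u].
    by rewrite addr0.
  rewrite /rho1; case: (eqVneq u v) => [->|_]; rewrite ?andbT ?andbF //.
  by rewrite rho0_short //; apply/negbTE; rewrite neq_ltn offv orbT.
have [w wv wc] := off_onto long.
rewrite (wt_chain_const gd wtg (esym wv)).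
have rw : rho0 w = (c + w)%N by rewrite /rho0 wc ltnn.
have := path_wt rho0_inj (rho0 w) card_rho0 gd wtg.
rewrite (bigD1 w) //= big1 ?addr0 // => u /andP[/eqP + /eqP uw].
rewrite rw /rho0; case: ifP => [+ E|_ /addnI/val_inj//].
by rewrite E ltnNge leq_addr.
Qed.

Definition end_wt (b : bool) v : int :=
  b%:R * ((chain_index I v == 0%N)%:R - (chain_index I v == (nchains I).-1)%:R).

Lemma common_minor_neq0 :
  exists f' g' : 'I_(s + c) -> 'I_n, \det (mxsub f' g' (M_nilrad F I ^+ r.+1)) != 0.
Proof. exact: (path_minor_neq0 F rho0_inj card_rho0). Qed.

Lemma common_divisor_neq0 g : common_divisor g -> g != 0.
Proof.
move=> gd; have [f' [g' dN0]] := common_minor_neq0.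
by have [q dE] := gd f' g'; apply: contraNneq dN0 => g0; rewrite dE g0 mulr0.
Qed.

(* A nonzero minor has weight at most 1 at a vertex of the first chain, and the
   cofactor of [g] in it has nonnegative weight there. *)
Lemma common_divisor_wt g : common_divisor g -> exists b, wt g (end_wt b).
Proof.
move=> gd; have [f' [g' dN0]] := common_minor_neq0.
have [chi wtg] := divides_minors_wt gd dN0.
have len0 : (0 < chain_length I 0)%N by rewrite first_c c_gt0.
have lenl : (0 < chain_length I (nchains I).-1)%N by rewrite last_c c_gt0.
have [v0 v0c v0o] := off_onto len0; have [vl vlc vlo] := off_onto lenl.
have v0Nvl : vl != v0.
  apply/eqP => E; move: vlc; rewrite E v0c => /esym/eqP.
  by rewrite -leqn0 leqNgt -subn1 subn_gt0 chains_ge2.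
have chi_mid v : chain_index I v != 0%N -> chain_index I v != (nchains I).-1 -> chi v = 0.
  move=> vN0 vNl; apply: (wt_eq0_mid gd wtg); apply: mid_c; first by rewrite lt0n.
  by have := chain_index_bound I v; move: vNl; lia.
(* The path labelled 0 consists of the first vertices of all chains, and those of the middle chains
   have weight 0. *)
have sum0 : chi v0 + chi vl = 0.
  have := path_wt rho0_inj (0%N) card_rho0 gd wtg.
  have rho00 v : (rho0 v == 0%N) = (off I v == 0%N).
    rewrite /rho0; case: ifP => // oc; rewrite addn_eq0 eqn0Ngt c_gt0 /=.
    by move: oc c_gt0; lia.
  rewrite (eq_bigl _ _ rho00) (bigD1 v0) ?v0o //= (bigD1 vl) ?vlo ?v0Nvl //=.
  rewrite big1 ?addr0 // => v /andP[/andP[/eqP v_0 vNv0] vNvl]; apply: chi_mid.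
    by apply: contra_neq vNv0 => v0'; apply: (@off_inj _ I); rewrite ?v0' ?v_0 ?v0o.
  by apply: contra_neq vNvl => vl'; apply: (@off_inj _ I); rewrite ?vl' ?v_0 ?vlo.
have chiE v : chi v = chi v0 * ((chain_index I v == 0%N)%:R - (chain_index I v == (nchains I).-1)%:R).
  have [v_0|vN0] := eqVneq (chain_index I v) 0%N.
    have -> : (chain_index I v == (nchains I).-1) = false.
      by rewrite v_0; move: chains_ge2; lia.
    by rewrite subr0 mulr1 (wt_chain_const gd wtg (u := v) (v := v0)) // v_0.
  have [v_l|vNl] := eqVneq (chain_index I v) (nchains I).-1.
    rewrite sub0r mulrN1 (wt_chain_const gd wtg (u := v) (v := vl)) ?vlc //.
    by apply/eqP; rewrite -addr_eq0 addrC sum0.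
  by rewrite subr0 mulr0 chi_mid.
have chi_ge0 : 0 <= chi v0.
  exact: (wt_first_chain_ge0 (common_divisor_neq0 gd) wtg).
have chi_le1 : chi v0 <= 1.
  have [q dE] := gd f' g'.
  have [psi wtq] : exists psi, wt q psi.
    have := @minor_homog F n I 1 (fun=> 0) r.+1 _ f' g'.
    have := @wt_minor F n I r.+1 _ f' g'.
    rewrite dE => w1 w2; apply: wt_factor w2 w1; by rewrite -dE.
  have q0 : q != 0 by apply: contraNneq dN0 => q0; rewrite dE q0 mul0r.
  have := wt_uniq dN0 (@wt_minor F n I r.+1 _ f' g').
  rewrite [in X in wt X]dE => /(_ _ (wtM wtq wtg) v0) E.
  have : psi v0 + chi v0 <= 1.
    rewrite -E sumrB (le_trans (y := \sum_i (g' i == v0)%:R)) //.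
      by rewrite gerBl sumr_ge0 // => i _; case: (_ == _).
    (* A minor with a repeated column is 0, so [g'] takes the value [v0] at most once. *)
    case: (boolP (injectiveb g')) => [/injectiveP gi|/injectiveP gN]; last first.
      by rewrite minor_noninj_col ?eqxx // in dN0.
    have [[i gv]|Ng] : (exists i, g' i == v0) \/ forall i, (g' i == v0) = false.
      case: (boolP [exists i, g' i == v0]) => [/existsP|/existsPn] E'; [by left|right].
      by move=> i; apply/negbTE.
    - rewrite (bigD1 i) //= big1 ?addr0 => [|j ji]; first by case: (_ == _).
      by case: eqP => // gj; case/eqP: ji; apply: gi; rewrite gj (eqP gv).
    - by rewrite big1 // => i _; rewrite Ng.
  by apply: le_trans; rewrite lerDr (wt_first_chain_ge0 q0 wtq).
exists (chi v0 == 1) => m mp v; rewrite (wtg _ mp) chiE /end_wt.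
by congr (_ * _); move: chi_ge0 chi_le1; case: eqP; lia.
Qed.

Lemma end_wt0_const g : wt g (end_wt false) -> g = (g@_0)%:MP.
Proof.
by move=> wtg; apply: wt0_const => m mg v; rewrite (wtg m mg) /end_wt mul0r.
Qed.

Lemma end_wt_last v : val v = n.-1 -> end_wt true v = -1.
Proof.
move=> vn; rewrite /end_wt chain_index_last // eqxx.
have -> : ((nchains I).-1 == 0%N) = false.
  by clear -chains_ge2; move: chains_ge2; lia.
by rewrite mul1r sub0r.
Qed.

End EndChains.

(** * Knuth equivalence and row insertion *)

Section KnuthEquivalence.

Inductive knuth_step : seq nat -> seq nat -> Prop :=
| KnuthLeft u v a b c of (a < b)%N & (b < c)%N :
    knuth_step (u ++ [:: b; a; c] ++ v) (u ++ [:: b; c; a] ++ v)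
| KnuthRight u v a b c of (a < b)%N & (b < c)%N :
    knuth_step (u ++ [:: a; c; b] ++ v) (u ++ [:: c; a; b] ++ v).

Inductive knuth : seq nat -> seq nat -> Prop :=
| knuth_refl s : knuth s s
| knuth_next s t w of knuth_step s t & knuth t w : knuth s w
| knuth_prev s t w of knuth_step t s & knuth t w : knuth s w.

Lemma knuth_trans s t w : knuth s t -> knuth t w -> knuth s w.
Proof.
elim=> // {}s t' t'' st' _ IH tw; first exact: knuth_next st' (IH tw).
exact: knuth_prev st' (IH tw).
Qed.

Lemma knuth_step_cat x y s t : knuth_step s t -> knuth_step (x ++ s ++ y) (x ++ t ++ y).
Proof.
by case=> u v a b c ab bc; rewrite -!catA !(catA x u); [apply: KnuthLeft|apply: KnuthRight].
Qed.

Lemma knuth_cat x y s t : knuth s t -> knuth (x ++ s ++ y) (x ++ t ++ y).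
Proof.
elim=> {s t} [s|s t w st _|s t w ts _]; first exact: knuth_refl.
  by apply: knuth_next; apply: knuth_step_cat.
by apply: knuth_prev; apply: knuth_step_cat.
Qed.

Lemma knuth_step_perm s t : knuth_step s t -> perm_eq s t.
Proof.
case=> u v a b c _ _; rewrite perm_cat2l perm_cat2r.
  by rewrite -[[:: b; a; c]]/([:: b] ++ [:: a; c]) -[[:: b; c; a]]/([:: b] ++ [:: c; a])
    perm_cat2l (perm_catC [:: a] [:: c]).
by rewrite -[[:: a; c; b]]/([:: a; c] ++ [:: b]) -[[:: c; a; b]]/([:: c; a] ++ [:: b])
  perm_cat2r (perm_catC [:: a] [:: c]).
Qed.

(** The first half of bumping [y] by [x]: the new letter moves left through the larger letters after
    [y]. In each Knuth move the middle-sized letter is the one to the left of the exchanged pair. *)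
Lemma knuth_bump_right x y s : (x < y)%N -> path ltn y s ->
  knuth (y :: s ++ [:: x]) [:: y, x & s].
Proof.
move=> xy; elim/last_ind: s => [|s z IHs]; first by move=> _; apply: knuth_refl.
rewrite rcons_path => /andP[ys lastz].
have x_last : (x < last y s)%N.
  case/lastP: s ys {IHs lastz} => // s t; rewrite last_rcons => /(order_path_min ltn_trans).
  by rewrite all_rcons => /andP[/(ltn_trans xy)].
apply: (@knuth_prev _ ((y :: s ++ [:: x]) ++ [:: z])).
  have -> : y :: rcons s z ++ [:: x] = belast y s ++ [:: last y s; z; x] ++ [::].
    by rewrite cats0 -[RHS]cat_rcons -lastI /= -cats1 -catA.
  have -> : (y :: s ++ [:: x]) ++ [:: z] = belast y s ++ [:: last y s; x; z] ++ [::].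
    by rewrite cats0 -[RHS]cat_rcons -lastI /= -catA.
  exact: KnuthLeft.
by rewrite -(cats1 s z); have := knuth_cat [::] [:: z] (IHs ys).
Qed.

(** The second half: the bumped [y] moves left through the letters smaller than [x]. The
    middle-sized letter is now to the right of the exchanged pair. *)
Lemma knuth_bump_left x y s : (x < y)%N -> sorted ltn (rcons s x) ->
  knuth (s ++ [:: y; x]) (y :: rcons s x).
Proof.
elim/last_ind: s x => [|s z IHs] x xy; first by move=> _; apply: knuth_refl.
move=> sx; have sz : sorted ltn (rcons s z).
  by move: sx; rewrite -cats1 => /cat_sorted2[].
have zx : (z < x)%N.
  by move: sx; rewrite -!cats1 -catA => /cat_sorted2[_] /= /andP[].
apply: (@knuth_next _ (s ++ [:: y; z; x])).
  by rewrite -!cats1 -catA /= -[_ ++ _]cats0 -[X in knuth_step _ X]cats0 -!catA; apply: KnuthRight.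
have := knuth_cat [::] [:: x] (IHs z (ltn_trans zx xy) sz).
by rewrite /= -!catA /= -(cats1 (rcons s z)).
Qed.

Definition reading (T : tableau) : seq nat := flatten (rev T).

Lemma reading_cons R T : reading (R :: T) = reading T ++ R.
Proof. by rewrite /reading rev_cons flatten_rcons. Qed.

Lemma perm_reading T : perm_eq (reading T) (flatten T).
Proof. by apply: perm_flatten; rewrite perm_rev. Qed.

Lemma row_insert_split R x : sorted ltn R -> x \notin R -> has (fun y => x < y)%N R ->
  exists R1 y R2, [/\ R = R1 ++ y :: R2, (x < y)%N, sorted ltn (rcons R1 x), path ltn x R2
    & forall T, row_insert (R :: T) x = (R1 ++ x :: R2) :: row_insert T y].
Proof.
move=> sR xR hx; have kR : (find (fun y => x < y)%N R < size R)%N by rewrite -has_find.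
set k := find _ R in kR; pose y := nth 0%N R k.
have xy : (x < y)%N by apply: (nth_find 0%N hx).
have RE : R = take k R ++ y :: drop k.+1 R by rewrite -drop_nth // cat_take_drop.
exists (take k R), y, (drop k.+1 R); split=> // [||T].
- rewrite sorted_pairwise; last exact: ltn_trans.
  rewrite pairwise_rcons -sorted_pairwise; last exact: ltn_trans.
  apply/andP; split; last by move: sR; rewrite {1}RE => /cat_sorted2[].
  apply/allP => z zk; have zR := mem_take zk; case/(nthP 0%N): zk => i.
  rewrite size_takel ?(ltnW kR) // => ik; rewrite nth_take // => zE.
  have := before_find 0%N ik; rewrite zE => /negbT; rewrite -leqNgt leq_eqVlt.
  by case/orP => // /eqP zx; rewrite -zx zR in xR.
- move: (sR); rewrite {1}RE => /cat_sorted2[_] /= /(order_path_min ltn_trans)/allP yR2.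
  move: sR; rewrite {1}RE => /cat_sorted2[_] /= /path_sorted.
  case: (drop k.+1 R) yR2 => //= z R2 yR2 ->.
  by rewrite andbT (ltn_trans xy) // yR2 ?mem_head.
- rewrite /= -/k kR -/y; congr (_ :: _).
  by rewrite set_nthE kR.
Qed.

(** The top row R1 y R2 followed by [x] is Knuth equivalent to y followed by R1 x R2. As lower rows
    are read earlier, [y] then stands right after them, ready to be inserted there. *)
Lemma row_insert_knuth T x : all (sorted ltn) T -> uniq (x :: flatten T) ->
  [/\ knuth (reading T ++ [:: x]) (reading (row_insert T x)),
      all (sorted ltn) (row_insert T x)
    & perm_eq (flatten (row_insert T x)) (x :: flatten T)].
Proof.
elim: T x => [|R T IHT] x; first by split=> //; apply: knuth_refl.
case/andP=> sR sT; rewrite -cat1s -[flatten (R :: T)]/(R ++ flatten T) cat1s cons_uniq => /andP[xRT uRT].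
have xR : x \notin R by move: xRT; rewrite mem_cat negb_or => /andP[].
case: (boolP (has (fun y => x < y)%N R)) => [hx|hNx].
  have [R1 [y [R2 [RE xy s1 s2 ->]]]] := row_insert_split sR xR hx.
  have uyT : uniq (y :: flatten T).
    move: uRT; rewrite cat_uniq => /and3P[_ /hasPn RT uT]; rewrite /= uT andbT.
    by apply/negP => /RT/negP[]; rewrite RE /= mem_cat mem_head orbT.
  have [k sT' pT'] := IHT y sT uyT; split.
  - rewrite !reading_cons -catA RE.
    have k2 : knuth (R1 ++ y :: R2 ++ [:: x]) (y :: R1 ++ x :: R2).
      have yR2 : path ltn y R2.
        by move: sR; rewrite RE => /cat_sorted2[].
      apply: (@knuth_trans _ (R1 ++ [:: y, x & R2])).
        by have := knuth_cat R1 [::] (knuth_bump_right xy yR2); rewrite !cats0.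
      have := knuth_cat [::] R2 (knuth_bump_left xy s1).
      by rewrite /= -catA /= cat_rcons.
    have := knuth_cat (reading T) [::] k2; rewrite !cats0 -catA /= => h.
    apply: knuth_trans h _.
    have := knuth_cat [::] (R1 ++ x :: R2) k; rewrite /= -catA /=.
    by [].
  - apply/andP; split; last exact: sT'; rewrite -cat_rcons.
    case/lastP: R1 s1 {RE} => [|R1 z] s1 /=; first exact: s2.
    case: R1 s1 => [|z' R1] /=; first by rewrite s2 andbT.
    by rewrite cat_path => ->; rewrite last_rcons s2.
  - rewrite [flatten _]/= RE -!catA perm_sym -cat1s perm_catCA perm_cat2l /=.
    rewrite perm_cons.
    rewrite perm_sym (perm_trans (perm_cat (perm_refl R2) pT')) //.
    by rewrite -cat1s -[y :: _]cat1s perm_catCA.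
have Rx : all (fun y => y < x)%N R.
  apply/allP => y yR; move/hasPn/(_ y yR): hNx; rewrite -leqNgt leq_eqVlt => /orP[/eqP yx|//].
  by rewrite -yx yR in xR.
have -> : row_insert (R :: T) x = rcons R x :: T.
  by rewrite /= -has_find (negPf hNx).
split.
- by rewrite !reading_cons -catA cats1; apply: knuth_refl.
- apply/andP; split; last exact: sT; case: R sR Rx {xRT uRT xR hNx IHT} => // z R sR Rx.
  rewrite /= rcons_path; apply/andP; split; first exact: sR.
  exact: (allP Rx _ (mem_last z R)).
- by rewrite /= -cats1 -catA -cat1s perm_catCA.
Qed.

Lemma knuth_RS w : uniq w -> knuth w (reading (RS_insertion w)).
Proof.
move=> uw; suff [] : [/\ knuth w (reading (RS_insertion w)),
    all (sorted ltn) (RS_insertion w) & perm_eq (flatten (RS_insertion w)) w] by [].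
elim/last_ind: w uw => [|w x IHw]; first by split=> //; apply: knuth_refl.
rewrite rcons_uniq /RS_insertion -cats1 foldl_cat /= => /andP[xw uw].
have [k s p] := IHw uw; have [|k' s' p'] := row_insert_knuth s (x := x).
  by rewrite /= (perm_mem p) xw (perm_uniq p).
split=> //.
  by apply: knuth_trans k'; have := knuth_cat [::] [:: x] k.
by rewrite (perm_trans p') // cats1 perm_sym perm_rcons perm_cons perm_sym.
Qed.

End KnuthEquivalence.

(** * Standard tableaux are recovered from their reading words *)

Section StandardTableaux.

Fixpoint above (R R' : seq nat) : bool :=
  match R, R' with
  | x :: R1, y :: R1' => (x < y)%N && above R1 R1'
  | _, [::] => true
  | [::], _ :: _ => false
  end.

Definition standard (T : tableau) : bool :=
  all (fun R => (R != [::]) && sorted ltn R) T && sorted above T.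

(** Each letter of [R] exceeds the letters [A] already placed and is smaller than the first
    remaining letter of [R'], so it bumps exactly that one. The row [R'] thus drops into [T] letter
    by letter, in order. *)
Lemma insert_row R R' A T : above R R' -> sorted ltn (A ++ R) ->
  foldl row_insert ((A ++ R') :: T) R = (A ++ R) :: foldl row_insert T R'.
Proof.
elim: R R' A T => [|x R IHR] [|y R'] A T //= => [_|/andP[xy RR']] sA.
  have -> : find (fun y => x < y)%N (A ++ [::]) = size A.
    rewrite cats0; apply/eqP; rewrite eqn_leq find_size leqNgt -has_find.
    apply/hasPn => y yA; rewrite -leqNgt ltnW //.
    move: sA; rewrite sorted_pairwise; last exact: ltn_trans.
    rewrite pairwise_cat => /and3P[/allrelP/(_ y x yA) + _ _].
    by move=> /(_ (mem_head _ _)).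
  rewrite cats0 ltnn -[rcons A x]cats0.
  by rewrite (IHR [::]) ?cat_rcons //; case: (R).
have Ax : all (fun z => z < x)%N A.
  apply/allP => z zA; move: sA; rewrite sorted_pairwise; last exact: ltn_trans.
  rewrite pairwise_cat => /and3P[/allrelP/(_ z x zA) + _ _].
  by move=> /(_ (mem_head _ _)).
have -> : find (fun y => x < y)%N (A ++ y :: R') = size A.
  rewrite find_cat /= xy addn0 ifF //; apply/negP => /hasP[z /(allP Ax)].
  by move=> /ltnW; rewrite leqNgt => /negPf->.
rewrite size_cat /= -[X in (X < _)%N]addn0 ltn_add2l /=.
rewrite nth_cat ltnn subnn /= set_nthE size_cat -[X in (X < _)%N]addn0 ltn_add2l /=.
rewrite take_size_cat // drop_cat ltnNge leqnSn /= subSnn drop1 /=.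
by rewrite -cat_rcons IHR ?cat_rcons.
Qed.

Lemma insert_top_row R T : standard (R :: T) -> foldl row_insert T R = R :: T.
Proof.
elim: T R => [|R' T IHT] R; rewrite /standard /= => /andP[/andP[/andP[R0 sR] sT] RT].
  case: R R0 sR {sT RT} => // x R _ /= xR.
  have := @insert_row R [::] [:: x] [::].
  by rewrite /= => -> //; case: (R).
move: RT => /andP[RR' RT].
by rewrite (insert_row (A := [::])) //= IHT // /standard /= sT RT.
Qed.

Lemma RS_reading T : standard T -> RS_insertion (reading T) = T.
Proof.
elim: T => //= R T IHT sRT; rewrite reading_cons /RS_insertion foldl_cat.
rewrite -[foldl _ _ (reading T)]/(RS_insertion (reading T)) IHT ?insert_top_row //.
by move: sRT; rewrite /standard /= => /andP[/andP[_ ->] /path_sorted].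
Qed.

End StandardTableaux.

(** * Knuth moves as conjugations by elementary matrices *)

Lemma trig_mulmx (R : nzRingType) n (A B : 'M[R]_n) :
  is_trig_mx A -> is_trig_mx B -> is_trig_mx (A *m B).
Proof.
move=> /is_trig_mxP At /is_trig_mxP Bt; apply/is_trig_mxP => i j ij.
rewrite mxE big1 // => k _; have [ik|ki] := ltnP i k; first by rewrite At ?mul0r.
by rewrite Bt ?mulr0 // (leq_ltn_trans ki).
Qed.

Section WordSpaces.
Variables (F : numFieldType) (n : nat).
Implicit Types (X Y : 'M[F]_n) (s t : seq nat) (p : {mpoly F[n * n]}).

Definition before s (i j : nat) : bool := (index i s < index j s)%N.

(* For the word [s] of a permutation w this is the space n \cap w(n). *)
Definition word_space s Y : Prop :=
  forall i j : 'I_n, Y i j != 0 -> (i < j)%N && before s i j.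

Definition vanishes_on_word s p : Prop :=
  forall b Y, group_B b -> word_space s Y -> mxeval p (b *m Y *m invmx b) = 0.

Lemma word_space_line s Y D tau :
  word_space s Y -> word_space s D -> word_space s (Y + tau *: D).
Proof.
move=> hY hD i j; rewrite !mxE => h; have [Y0|/hY//] := eqVneq (Y i j) 0.
by apply: hD; apply: contra_neq h => ->; rewrite Y0 mulr0 addr0.
Qed.

Lemma group_B_mul (b h : 'M[F]_n) : group_B b -> group_B h -> group_B (b *m h).
Proof.
move=> [bu bt] [hu ht]; split; first by rewrite /group_G unitmx_mul bu.
by rewrite trmx_mul; apply: trig_mulmx.
Qed.

Lemma group_B_elem (x y : 'I_n) tau : (x < y)%N ->
  group_B (1%:M + tau *: delta_mx x y : 'M[F]_n).
Proof.
move=> xy; have tr : is_trig_mx (1%:M + tau *: delta_mx x y : 'M[F]_n)^T.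
  apply/is_trig_mxP => i j ij; rewrite !mxE -val_eqE gtn_eqF //= add0r.
  case: (j =P x) => [jx|_]; rewrite ?mulr0 //=; case: (i =P y) => [iy|_]; rewrite ?mulr0 //.
  by move: ij; rewrite jx iy ltnNge ltnW.
split=> //; rewrite -unitmx_tr unitmxE det_trig // big1 ?unitr1 // => i _.
rewrite !mxE eqxx; case: (i =P x) => [->|_]; rewrite ?mulr0 ?addr0 //=.
by rewrite -val_eqE ltn_eqF // mulr0 addr0.
Qed.

Lemma elem_inverse (x y : 'I_n) tau : x != y ->
  (1%:M - tau *: delta_mx x y : 'M[F]_n) *m (1%:M + tau *: delta_mx x y) = 1%:M.
Proof.
move=> xy; rewrite mulmxDr mulmx1 mulmxBl mul1mx -scalemxAl -scalemxAr.
by rewrite mul_delta_mx_0 1?eq_sym // !scaler0 subr0 subrK.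
Qed.

(** The term quadratic in [tau] carries the factor [Y y x], which is 0. *)
Lemma elem_conjE Y (x y : 'I_n) tau i j : Y y x = 0 ->
  ((1%:M + tau *: delta_mx x y) *m Y *m (1%:M - tau *: delta_mx x y)) i j
    = Y i j + tau * (i == x)%:R * Y y j - tau * (j == y)%:R * Y i x.
Proof.
move=> Yyx.
have leftE (A : 'M[F]_n) u v : (delta_mx x y *m A) u v = (u == x)%:R * A y v.
  rewrite mxE (bigD1 y) //= big1 ?addr0 => [|k ky]; rewrite mxE ?eqxx ?andbT //.
  by rewrite (negPf ky) andbF mul0r.
have rightE (A : 'M[F]_n) u v : (A *m delta_mx x y) u v = (v == y)%:R * A u x.
  rewrite mxE (bigD1 x) //= big1 ?addr0 => [|k ky]; rewrite mxE.
    by rewrite eqxx mulrC.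
  by rewrite (negPf ky) mulr0.
rewrite mulmxBr mulmx1 mulmxDl mul1mx -scalemxAl -scalemxAr.
have linE (A B C : 'M[F]_n) u v :
    (A + tau *: B - tau *: C) u v = A u v + tau * B u v - tau * C u v.
  by rewrite !mxE.
have addE (A B : 'M[F]_n) u v : (A + tau *: B) u v = A u v + tau * B u v.
  by rewrite !mxE.
rewrite linE rightE addE !leftE Yyx; ring.
Qed.

Lemma vanishes_on_word_sub s t p :
  (forall i j : 'I_n, (i < j)%N -> before t i j -> before s i j) ->
  vanishes_on_word s p -> vanishes_on_word t p.
Proof.
move=> ts hs b Y bB Yt; apply: hs => // i j /Yt/andP[ij bt].
by rewrite ij ts.
Qed.

(* The elementary matrix 1 + tau e_(x,y) clears the entry (a, c) of a matrix
   whose entry at the pivot (x', y') is nonzero. *)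
Lemma vanishes_on_word_elem s t p (a c x y x' y' : 'I_n) :
  (x < y)%N -> (x' < y')%N -> before s x' y' ->
  (forall i j : 'I_n, (i < j)%N -> before s i j -> (i, j) != (a, c) -> before t i j) ->
  (forall j : 'I_n, (y < j)%N -> before s y j -> (x, j) != (a, c) -> before t x j) ->
  (forall i : 'I_n, (i < x)%N -> before s i x -> (i, y) != (a, c) -> before t i y) ->
  (forall Y, word_space s Y -> Y x' y' != 0 -> exists tau,
     Y a c + tau * (a == x)%:R * Y y c - tau * (c == y)%:R * Y a x = 0) ->
  vanishes_on_word t p -> vanishes_on_word s p.
Proof.
move=> xy xy' sxy' st1 st2 st3 piv ht b Y bB Ys.
pose D : 'M[F]_n := delta_mx x' y'.
have Ds : word_space s D.
  move=> i j; rewrite mxE; case: (i =P x') => [->|_]; rewrite ?eqxx //.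
  by case: (j =P y') => [->|_]; rewrite ?eqxx //= xy'.
(* A shift along [D] makes the pivot non-zero for every parameter but [- Y x' y']. *)
apply: (@mxeval_line_eq0 _ _ _ _ (b *m D *m invmx b) [:: - Y x' y']) => tau.
rewrite inE => tauN.
have -> : b *m Y *m invmx b + tau *: (b *m D *m invmx b)
    = b *m (Y + tau *: D) *m invmx b.
  by rewrite mulmxDr mulmxDl -scalemxAr -scalemxAl.
have := word_space_line (tau := tau) Ys Ds; set Y1 := Y + _ => Y1s.
have [|sig sigE] := piv _ Y1s.
  by rewrite !mxE !eqxx mulr1 addrC; apply: contra_neq tauN => /eqP; rewrite addr_eq0 => /eqP.
have xNy : x != y by rewrite -val_eqE ltn_eqF.
have Yyx : Y1 y x = 0.
  by apply/eqP/negPn/negP => /Y1s /andP[]; rewrite ltnNge ltnW.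
pose h : 'M[F]_n := 1%:M + sig *: delta_mx x y.
pose h' : 'M[F]_n := 1%:M - sig *: delta_mx x y.
have h'h : h' *m h = 1%:M by apply: elem_inverse.
have h'B : group_B h' by rewrite /h' -scaleNr; apply: group_B_elem.
have Zt : word_space t (h *m Y1 *m h').
  move=> i j; rewrite elem_conjE // => Zij.
  have ijN : (i, j) != (a, c) by apply: contra_neq Zij => -[-> ->].
  have [Y0|/Y1s/andP[ij sij]] := eqVneq (Y1 i j) 0; last by rewrite ij st1.
  have [z1|] := eqVneq ((i == x)%:R * Y1 y j) 0; last first.
    case: (i =P x) ijN => [-> ijN|_]; rewrite ?mul0r ?eqxx // mul1r.
    by move=> /Y1s/andP[yj syj]; rewrite (ltn_trans xy yj) st2.
  have [z2|] := eqVneq ((j == y)%:R * Y1 i x) 0.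
    by move: Zij; rewrite Y0 -!mulrA z1 z2 !mulr0 addr0 subrr eqxx.
  case: (j =P y) ijN => [-> ijN|_]; rewrite ?mul0r ?eqxx // mul1r.
  by move=> /Y1s/andP[ix six]; rewrite (ltn_trans ix xy) st3.
have := ht (b *m h') _ (group_B_mul bB h'B) Zt.
have -> : invmx (b *m h') = h *m invmx b.
  have bu : b \in unitmx by case: bB.
  have h'u : h' \in unitmx by case: h'B.
  have bh : (h *m invmx b) *m (b *m h') = 1%:M.
    by rewrite mulmxA mulmxKV // (mulmx1C h'h).
  by rewrite -[RHS](@mulmxK _ _ _ (b *m h')) ?bh ?mul1mx // unitmx_mul bu.
by rewrite !mulmxA -(mulmxA b) h'h mulmx1 -(mulmxA _ h') h'h mulmx1.
Qed.

Lemma index3 (u v : seq nat) x y z w : uniq (u ++ [:: x; y; z] ++ v) ->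
  index w (u ++ [:: x; y; z] ++ v) =
    if w == x then size u else if w == y then (size u).+1
    else if w == z then (size u).+2
    else if w \in u then index w u else ((size u).+3 + index w v)%N.
Proof.
rewrite cat_uniq => /and3P[_ /hasPn uN]; rewrite /= !inE !negb_or.
case/and4P => /andP[xy /andP[xz _]] /andP[yz _] _ _.
have [xu yu zu] : [/\ x \notin u, y \notin u & z \notin u].
  by split; apply: uN; rewrite !inE eqxx ?orbT.
rewrite index_cat /= !(eq_sym _ w).
case: eqP => [->|_]; first by rewrite (negPf xu) addn0.
case: eqP => [->|_]; first by rewrite (negPf yu) addn1.
case: eqP => [->|_]; first by rewrite (negPf zu) addn2.
by case: ifP => // _; rewrite !addnS !addSn.
Qed.

Local Ltac knuth_lia :=
  do ?[case: eqP => ?]; do ?[case: (boolP (_ \in _)) => [_ /(_ isT) ?|_ _]];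
  move=> //; lia.

(** The words differ only in the order of a < c, so the space of [t] is the hyperplane Y a c = 0 in
    the space of [s]. A generic [Y] in the larger space is conjugated into it: if b stands to the
    left of the pair, a multiple of row b is added to row a, with pivot (b, c); if b stands to the
    right, a multiple of column b is subtracted from column c, with pivot (a, b). *)
Lemma vanishes_on_knuth_step s t p : knuth_step s t -> perm_eq s (iota 0 n) ->
  vanishes_on_word s p <-> vanishes_on_word t p.
Proof.
move=> st sn; have tn : perm_eq t (iota 0 n).
  by rewrite -(permPl (knuth_step_perm st)).
have us : uniq s by rewrite (perm_uniq sn) iota_uniq.
have ut : uniq t by rewrite (perm_uniq tn) iota_uniq.
have ltn_s x : x \in s -> (x < n)%N by rewrite (perm_mem sn) mem_iota.
case: st us ut ltn_s {sn tn} => u v a b c ab bc us ut ltn_s.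
- have [an bn cn] : [/\ (a < n)%N, (b < n)%N & (c < n)%N].
    by split; apply: ltn_s; rewrite !mem_cat !inE eqxx ?orbT.
  have iu w : w \in u -> (index w u < size u)%N by rewrite index_mem.
  split.
    apply: vanishes_on_word_sub => i j ij; rewrite /before !index3 //.
    have := iu i; have := iu j; knuth_lia.
  apply: (@vanishes_on_word_elem _ _ _ (Ordinal an) (Ordinal cn) (Ordinal an) (Ordinal bn)
    (Ordinal bn) (Ordinal cn)) => //.
  + rewrite /before !index3 //=; knuth_lia.
  + move=> i j ij; rewrite /before !index3 // xpair_eqE -!val_eqE /=.
    have := iu i; have := iu j; knuth_lia.
  + move=> j /= bj; rewrite /before !index3 // xpair_eqE -!val_eqE /=.
    have := iu j; knuth_lia.
  + move=> i /= ia; rewrite /before !index3 // xpair_eqE -!val_eqE /=.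
    have := iu i; knuth_lia.
  move=> Y _ Ybc; exists (- Y (Ordinal an) (Ordinal cn) / Y (Ordinal bn) (Ordinal cn)).
  by rewrite eqxx mulr1 mulfVK // -val_eqE gtn_eqF //= mulr0 mul0r subr0 subrr.
- have [an bn cn] : [/\ (a < n)%N, (b < n)%N & (c < n)%N].
    by split; apply: ltn_s; rewrite !mem_cat !inE eqxx ?orbT.
  have iu w : w \in u -> (index w u < size u)%N by rewrite index_mem.
  split.
    apply: vanishes_on_word_sub => i j ij; rewrite /before !index3 //.
    have := iu i; have := iu j; knuth_lia.
  apply: (@vanishes_on_word_elem _ _ _ (Ordinal an) (Ordinal cn) (Ordinal bn) (Ordinal cn)
    (Ordinal an) (Ordinal bn)) => //.
  + rewrite /before !index3 //=; knuth_lia.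
  + move=> i j ij; rewrite /before !index3 // xpair_eqE -!val_eqE /=.
    have := iu i; have := iu j; knuth_lia.
  + move=> j /= bj; rewrite /before !index3 // xpair_eqE -!val_eqE /=.
    have := iu j; knuth_lia.
  + move=> i /= ia; rewrite /before !index3 // xpair_eqE -!val_eqE /=.
    have := iu i; knuth_lia.
  move=> Y _ Yab; exists (Y (Ordinal an) (Ordinal cn) / Y (Ordinal an) (Ordinal bn)).
  by rewrite eqxx mulr1 mulfVK // -val_eqE ltn_eqF //= mulr0 mul0r addr0 subrr.
Qed.

Lemma vanishes_on_knuth s t p : knuth s t -> perm_eq s (iota 0 n) ->
  vanishes_on_word s p <-> vanishes_on_word t p.
Proof.
elim=> {s t} [s|s t w st _ IH sn|s t w ts _ IH sn] //.
  have tn : perm_eq t (iota 0 n) by rewrite -(permPl (knuth_step_perm st)).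
  exact: iff_trans (vanishes_on_knuth_step _ st sn) (IH tn).
have tn : perm_eq t (iota 0 n) by rewrite (permPl (knuth_step_perm ts)).
exact: iff_trans (iff_sym (vanishes_on_knuth_step _ ts tn)) (IH tn).
Qed.

Lemma vanishes_on_RS s t p : perm_eq s (iota 0 n) -> perm_eq t (iota 0 n) ->
  RS_insertion s = RS_insertion t ->
  vanishes_on_word s p <-> vanishes_on_word t p.
Proof.
move=> sn tn E.
have us : uniq s by rewrite (perm_uniq sn) iota_uniq.
have ut : uniq t by rewrite (perm_uniq tn) iota_uniq.
have h1 := vanishes_on_knuth p (knuth_RS us) sn.
have h2 := vanishes_on_knuth p (knuth_RS ut) tn.
by rewrite E in h1; apply: iff_trans h1 (iff_sym h2).
Qed.

End WordSpaces.

(** * The tableau T_I(l) *)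

Section RowTableaux.

Lemma before_reading (T : tableau) x y : uniq (flatten T) ->
  x \in flatten T -> y \in flatten T ->
  let row z := find (fun R => z \in R) T in
  (row y < row x)%N || (row x == row y) && before (nth [::] T (row x)) x y ->
  before (reading T) x y.
Proof.
elim: T => //= R T IHT; rewrite cat_uniq => /and3P[_ /hasPn RT uT].
have memT z : (z \in reading T) = (z \in flatten T) by rewrite (perm_mem (perm_reading T)).
have NT z : z \in R -> (z \in flatten T) = false.
  by move=> zR; apply/negP => /RT; rewrite /= zR.
rewrite !mem_cat reading_cons /before !index_cat !memT.
case: (boolP (x \in R)) => xR /=; case: (boolP (y \in R)) => yR //= xT yT.
- by rewrite !NT // ltn_add2l.
- by rewrite xT NT // ltn_addr // index_mem memT.
- by rewrite xT yT ltnS eqSS => h; apply: IHT.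
Qed.

Lemma sorted_before s x y : sorted ltn s -> x \in s -> y \in s ->
  (x < y)%N -> before s x y.
Proof.
move=> ss xs ys xy; rewrite /before ltnNge; apply/negP.
rewrite leq_eqVlt => /orP[/eqP E|yx].
  by move: xy; rewrite -(nth_index 0%N xs) -E nth_index // ltnn.
have := @sorted_ltn_index _ ltn ltn_trans s ss y x ys xs yx.
by rewrite /= ltnNge ltnW.
Qed.

Lemma sorted_nth_count s x : sorted ltn s -> x \in s ->
  nth 0%N s (count (fun y => y < x)%N s) = x.
Proof.
elim: s => //= y s IHs ys; have lt_y := order_path_min ltn_trans ys.
rewrite inE => /orP[/eqP->|xs].
  rewrite ltnn add0n (@eq_in_count _ _ pred0) ?count_pred0 // => z /(allP lt_y) /= yz.
  by rewrite ltnNge ltnW.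
by rewrite (allP lt_y _ xs) /= IHs // (path_sorted ys).
Qed.

(** For the entry [y] in position j of [R'] the condition says that more than j entries of [R] are
    smaller than [y], hence so is the one in position j. *)
Lemma above_count R R' : sorted ltn R -> sorted ltn R' ->
  (forall y, y \in R' ->
     count (fun x => x < y)%N R' < count (fun x => x < y)%N R)%N ->
  above R R'.
Proof.
elim: R R' => [|x R IHR] [|y R'] //= sR sR' h.
  by have := h y (mem_head _ _).
have ltx := order_path_min ltn_trans sR; have lty := order_path_min ltn_trans sR'.
have xy : (x < y)%N.
  have := h y (mem_head _ _); case: (ltnP x y) => // yx.
  rewrite /= add0n (@eq_in_count _ _ pred0 R) ?count_pred0 // => z /(allP ltx) /= xz.
  by rewrite ltnNge ltnW // (leq_ltn_trans yx).
rewrite xy IHR ?(path_sorted sR) ?(path_sorted sR') // => z zR'.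
have yz := allP lty _ zR'; have := h z; rewrite inE zR' orbT => /(_ isT) /=.
by rewrite yz (ltn_trans xy yz) ltn_add2l.
Qed.

Variables (n : nat) (rho : 'I_n -> nat) (K : nat).

Definition tab_row k : seq nat := [seq val v | v <- enum 'I_n & rho v == k].

(** A tableau encoded by its row function, so that standardness and the order of the reading word
    become conditions on [rho]. *)
Definition row_tab : tableau := mkseq tab_row K.

Lemma mem_tab_row k (v : 'I_n) : (val v \in tab_row k) = (rho v == k).
Proof. by rewrite (mem_map val_inj) mem_filter mem_enum andbT. Qed.

Lemma tab_rowP k x : reflect (exists2 v : 'I_n, x = val v & rho v = k) (x \in tab_row k).
Proof.
apply: (iffP mapP) => [[v + ->]|[v -> <-]].
  by rewrite mem_filter => /andP[/eqP vk _]; exists v.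
by exists v; rewrite // mem_filter eqxx mem_enum.
Qed.

Lemma sorted_tab_row k : sorted ltn (tab_row k).
Proof.
apply: (@subseq_sorted _ _ ltn_trans _ (iota 0 n)); last exact: iota_ltn_sorted.
by rewrite -val_enum_ord; apply: map_subseq; apply: filter_subseq.
Qed.

Lemma count_tab_row k (v : 'I_n) :
  count (fun x => x < v)%N (tab_row k) = #|[set u | (rho u == k) && (u < v)%N]|.
Proof.
rewrite count_map count_filter -sum1_count big_enum_cond /= sum1dep_card.
by apply: eq_card => u; rewrite !inE andbC.
Qed.

Hypothesis rho_lt : forall v, (rho v < K)%N.

Lemma perm_reading_row_tab : perm_eq (reading row_tab) (iota 0 n).
Proof.
have rowsP (e : seq 'I_n) k :
    perm_eq (flatten (mkseq (fun j => [seq val v | v <- e & rho v == j]) k))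
      [seq val v | v <- e & (rho v < k)%N].
  elim: k => [|k IHk]; first by rewrite (eq_filter (a2 := pred0)) ?filter_pred0.
  rewrite mkseqS flatten_rcons; apply/seq.permP => a.
  have /seq.permP/(_ a) IHa := IHk; rewrite count_cat IHa !count_map !count_filter.
  elim: e {IHk IHa} => //= v s; rewrite [(rho v < k.+1)%N]ltnS leq_eqVlt.
  by case: (a _); case: ltngtP => //=; lia.
rewrite (permPl (perm_reading _)) (permPl (rowsP _ _)) -val_enum_ord.
by rewrite (eq_filter (a2 := predT)) ?filter_predT // => v; apply: rho_lt.
Qed.

Lemma before_row_tab (u v : 'I_n) : (u < v)%N ->
  before (reading row_tab) u v = (rho v <= rho u)%N.
Proof.
move=> uv; have mem (w : 'I_n) : nat_of_ord w \in flatten row_tab.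
  rewrite -(perm_mem (perm_reading _)) (perm_mem perm_reading_row_tab) mem_iota.
  exact: ltn_ord.
have un : uniq (flatten row_tab).
  by rewrite -(perm_uniq (perm_reading _)) (perm_uniq perm_reading_row_tab) iota_uniq.
have findE (w : 'I_n) : find (fun R : seq nat => nat_of_ord w \in R) row_tab = rho w.
  rewrite /row_tab /mkseq find_map (eq_find (a2 := pred1 (rho w))).
    have := @index_uniq _ 0%N (rho w) (iota 0 K).
    by rewrite size_iota nth_iota // add0n iota_uniq; apply.
  by move=> k; rewrite /= mem_tab_row eq_sym.
have [vu|uv'] := leqP (rho v) (rho u).
  apply: before_reading => //=; rewrite !findE; move: vu.
  rewrite leq_eqVlt => /orP[/eqP vu|->//]; rewrite vu eqxx ltnn /=.
  rewrite nth_mkseq ?rho_lt //; apply: sorted_before => //.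
  - exact: sorted_tab_row.
  - by rewrite mem_tab_row.
  - by rewrite mem_tab_row vu.
have : before (reading row_tab) v u by apply: before_reading => //=; rewrite !findE uv'.
by rewrite /before ltnNge => /negbTE E; rewrite ltnNge leq_eqVlt negb_or; move: E; case: ltngtP.
Qed.

Lemma standard_row_tab : (forall k, (k < K)%N -> exists v, rho v = k) ->
  (forall v k, rho v = k.+1 ->
     #|[set u | (rho u == k.+1) && (u < v)%N]| < #|[set u | (rho u == k) && (u < v)%N]|)%N ->
  standard row_tab.
Proof.
move=> ne hrho; apply/andP; split.
  apply/allP => _ /mapP[k + ->]; rewrite mem_iota /= => /ne[v vk].
  rewrite sorted_tab_row andbT; apply/eqP => E.
  by have := mem_tab_row k v; rewrite E vk eqxx.
apply/(sortedP [::]) => k; rewrite size_mkseq => kK; rewrite !nth_mkseq ?(ltnW kK) //.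
apply: above_count; try exact: sorted_tab_row.
by move=> y /tab_rowP[v -> vk]; rewrite !count_tab_row hrho.
Qed.

End RowTableaux.

Section ChainTableau.
Variables (n : nat) (I : {set 'I_n.-1}) (c : nat).
Hypothesis chains_ge2 : (2 <= nchains I)%N.
Hypothesis first_c : chain_length I 0 = c.
Hypothesis last_c : chain_length I (nchains I).-1 = c.
Implicit Types u v w : 'I_n.

Lemma off_last v : val v = n.-1 -> off I v = c.-1.
Proof.
move=> vn; have c0 := c_gt0 chains_ge2 first_c.
have [|w wl woff] := @off_onto _ I (nchains I).-1 c.-1; first by rewrite last_c prednK.
have wv : chain_index I w = chain_index I v by rewrite wl chain_index_last.
rewrite -woff; congr (off _ _); apply/eqP/negPn/negP => /eqP vNw.
have : (off I w < off I v)%N.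
  rewrite off_ltE // ltn_neqAle vn -ltnS prednK ?ltn_ord ?andbT; last first.
    by apply: leq_ltn_trans (ltn_ord w).
  by apply/eqP => E; apply: vNw; apply/val_inj; exact: etrans vn (esym E).
by have := off_bound I v; rewrite chain_index_last // last_c woff; lia.
Qed.

Lemma chain_seq_sorted j : sorted ltn (chain_seq I j).
Proof.
apply: (@subseq_sorted _ _ ltn_trans _ (iota 0 n)); last exact: iota_ltn_sorted.
by rewrite -val_enum_ord; apply: map_subseq; rewrite enumT; apply: filter_subseq.
Qed.

Lemma nth_chain_seq v : nth 0%N (chain_seq I (chain_index I v)) (off I v) = v.
Proof.
rewrite -[RHS](sorted_nth_count (chain_seq_sorted (chain_index I v))); last first.
  by rewrite (mem_map val_inj) mem_enum mem_chain.
congr nth; rewrite count_map -sum1_count big_enum_cond /= sum1dep_card.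
by apply: eq_card => u; rewrite !inE.
Qed.

Definition chain_row i := nth [::] (T_chains I) i.

Lemma chain_rowE i : (i < \max_(j < nchains I) chain_length I j)%N ->
  chain_row i = sort leq [seq nth 0%N (chain_seq I j) i
                         | j <- iota 0 (nchains I) & (i < chain_length I j)%N].
Proof. exact: nth_mkseq. Qed.

Lemma chain_length_max j : (j < nchains I)%N ->
  (chain_length I j <= \max_(j < nchains I) chain_length I j)%N.
Proof. by move=> jI; apply: (leq_bigmax (Ordinal jI)). Qed.

Lemma off_lt_max v : (off I v < \max_(j < nchains I) chain_length I j)%N.
Proof. exact: leq_trans (off_bound I v) (chain_length_max (chain_index_bound I v)). Qed.

Lemma mem_chain_row i x :
  reflect (exists2 v, x = val v & off I v = i) (x \in chain_row i).
Proof.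
have [im|mi] := ltnP i (\max_(j < nchains I) chain_length I j); last first.
  rewrite /chain_row nth_default ?size_mkseq //; apply: ReflectF => -[v _ vi].
  by have := off_lt_max v; rewrite vi ltnNge mi.
rewrite chain_rowE // mem_sort; apply: (iffP mapP) => [[j + ->]|[v -> vi]].
  rewrite mem_filter => /andP[/off_onto[v vj vi] _]; exists v => //.
  by rewrite -vi -vj nth_chain_seq.
exists (chain_index I v); last by rewrite -vi nth_chain_seq.
by rewrite mem_filter -vi off_bound mem_iota chain_index_bound.
Qed.

Lemma uniq_chain_row i : uniq (chain_row i).
Proof.
have [im|mi] := ltnP i (\max_(j < nchains I) chain_length I j); last first.
  by rewrite /chain_row nth_default ?size_mkseq.
rewrite chain_rowE // sort_uniq map_inj_in_uniq ?filter_uniq ?iota_uniq // => j k.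
rewrite !mem_filter => /andP[/off_onto[v <- vi] _] /andP[/off_onto[w <- wi] _].
by rewrite -{1}vi -wi !nth_chain_seq => /val_inj->.
Qed.

(** The row function of T_I(l). Rows are counted from 0, so the last vertex goes from row c - 1 to
    row c. *)
Definition last_row v : nat := if val v == n.-1 then c else off I v.

Definition tab_height := maxn (\max_(j < nchains I) chain_length I j) c.+1.

Lemma last_row_lt v : (last_row v < tab_height)%N.
Proof. by rewrite /last_row leq_max; case: ifP => _; rewrite ?ltnSn ?orbT // off_lt_max. Qed.

Lemma last_vertex : exists v, val v = n.-1.
Proof.
have n0 := n_gt0 chains_ge2; have n1 : (n.-1 < n)%N by rewrite prednK.
by exists (Ordinal n1).
Qed.

Lemma T_chains_last_row_tab : T_chains_last I = row_tab last_row tab_height.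
Proof.
have c0 := c_gt0 chains_ge2 first_c; have [vn vnE] := last_vertex.
rewrite /T_chains_last /move_down first_c size_mkseq prednK //.
apply: (@eq_from_nth _ [::]) => [|i]; rewrite !size_mkseq // => iK.
rewrite [LHS]nth_mkseq // [RHS]nth_mkseq // -/(chain_row i).
apply: (sorted_eq leq_trans anti_leq); first exact: sort_sorted leq_total _.
  by apply: sub_sorted (sorted_tab_row _ _) => x y /ltnW.
rewrite perm_sort; apply: uniq_perm.
- case: ifP => _; first by rewrite rem_uniq // uniq_chain_row.
  case: ifP => [/eqP->|_]; rewrite ?uniq_chain_row //= uniq_chain_row andbT.
  apply/mem_chain_row => -[v vE vc]; have := off_last (esym vE); lia.
- exact: (sorted_uniq ltn_trans ltnn (sorted_tab_row last_row i)).
move=> x; apply/idP/tab_rowP => [|[v ->]].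
  have [->|ic1] := eqVneq i c.-1.
    rewrite mem_rem_uniq ?uniq_chain_row // inE => /andP[xn /mem_chain_row[v xv vi]].
    by exists v; rewrite // /last_row -xv (negPf xn).
  have [->|ic] := eqVneq i c.
    rewrite inE => /orP[/eqP->|/mem_chain_row[v xv vi]].
      by exists vn; rewrite // /last_row vnE eqxx.
    by exists v; rewrite // /last_row; case: ifP => // _; rewrite vi.
  move=> /mem_chain_row[v xv vi]; exists v => //; rewrite /last_row; case: eqP => // vn'.
  by have := off_last vn'; move: ic1; rewrite vi => /eqP.
rewrite /last_row; case: eqP => [vn'|vN] => <-.
  have -> : (c == c.-1) = false by lia.
  by rewrite eqxx vn' mem_head.
have [|oc] := eqVneq (off I v) c.-1.
  rewrite mem_rem_uniq ?uniq_chain_row // inE => vc; apply/andP; split; first exact/eqP.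
  by apply/mem_chain_row; exists v.
by case: ifP => _; rewrite ?inE; [apply/orP; right|]; apply/mem_chain_row; exists v.
Qed.

Lemma last_row_onto k : (k < tab_height)%N -> exists v, last_row v = k.
Proof.
have c0 := c_gt0 chains_ge2 first_c; have [vn vnE] := last_vertex.
have [->|kc] := eqVneq k c; first by exists vn; rewrite /last_row vnE eqxx.
move=> kK; have [v vN vk] : exists2 v, val v != n.-1 & off I v = k.
  have [->|kc1] := eqVneq k c.-1.
    (* Row c - 1 has lost the last vertex but keeps the end of the first chain. *)
    have [|v v0 vc] := @off_onto _ I 0%N c.-1; first by rewrite first_c prednK.
    exists v => //; apply/eqP => /(@chain_index_last _ I).
    by rewrite v0; move: chains_ge2; lia.
  have kmax : (k < \max_(j < nchains I) chain_length I j)%N.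
    have := @chain_length_max 0 (ltnW chains_ge2).
    by move: kK kc; rewrite first_c leq_max => /orP[//|]; lia.
  have [j kj] : exists j, (k < chain_length I j)%N.
    have [/existsP[j kj]|/existsPn N] :=
      boolP [exists j : 'I_(nchains I), (k < chain_length I j)%N]; first by exists j.
    move: kmax; rewrite ltnNge; case/negP; apply/bigmax_leqP => j _.
    by rewrite leqNgt.
  have [v vj vk] := off_onto kj; exists v => //; apply/eqP => /off_last.
  by rewrite vk; apply/eqP.
by exists v; rewrite /last_row (negPf vN).
Qed.

Lemma off_pred_ex k u : off I u = k.+1 ->
  exists w, (chain_index I w == chain_index I u) && (off I w == k).
Proof.
move=> uk; have [|w wu wk] := @off_onto _ I (chain_index I u) k.
  by have := off_bound I u; rewrite uk => /ltnW.
by exists w; rewrite wu wk !eqxx.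
Qed.

(** The predecessor in the chain maps row k + 1 injectively to row k and lowers the vertex.
    Strictness needs one more vertex of row k before [v] that is not the predecessor of a vertex
    counted on the left. *)
Lemma last_row_ballot v k : last_row v = k.+1 ->
  (#|[set u | (last_row u == k.+1) && (u < v)%N]|
     < #|[set u | (last_row u == k) && (u < v)%N]|)%N.
Proof.
have c0 := c_gt0 chains_ge2 first_c => vk.
pose g u := odflt u [pick w | (chain_index I w == chain_index I u) && (off I w == k)].
have gP u : off I u = k.+1 ->
    [/\ chain_index I (g u) = chain_index I u, off I (g u) = k & (g u < u)%N].
  move=> uk; rewrite /g; case: pickP => [w /andP[/eqP wu /eqP wk]|N] /=; last first.
    by have [w] := off_pred_ex uk; rewrite N.
  by split=> //; rewrite -(off_ltE wu) wk uk.
have ginj u w : off I u = k.+1 -> off I w = k.+1 -> g u = g w -> u = w.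
  move=> uk wk guw; apply: (@off_inj _ I); rewrite ?uk ?wk //.
  by have [<- _ _] := gP u uk; have [<- _ _] := gP w wk; rewrite guw.
have lt_last u : (val u < v)%N -> val u == n.-1 = false.
  by move=> uv; have := ltn_ord v; apply: contraTF => /eqP E; move: uv; lia.
pose A := [set u | (last_row u == k.+1) && (u < v)%N].
have AP u : u \in A -> off I u = k.+1 /\ (u < v)%N.
  by rewrite inE => /andP[/eqP + uv]; rewrite /last_row lt_last.
have gA : {in A &, injective g}.
  by move=> u w /AP[uk _] /AP[wk _]; apply: ginj.
have [w [wk wv wN]] : exists w, [/\ off I w = k, (w < v)%N & w \notin g @: A].
  move: vk; rewrite /last_row; case: eqP => [vn ck|vN vk].
    (* Here [v] is the moved vertex. The end of the first chain lies in row c - 1 and precedes no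
       vertex of its chain. *)
    have [|w w0 wc] := @off_onto _ I 0%N k; first by rewrite first_c ck.
    exists w; split=> //.
      rewrite ltn_neqAle; apply/andP; split; last by have := ltn_ord w; rewrite -/(val v) vn; lia.
      apply: contraTneq chains_ge2 => /val_inj wv.
      by have := chain_index_last I vn; rewrite -wv w0; lia.
    apply/negP => /imsetP[u /AP[uk _] E]; have [gu _ _] := gP u uk.
    by have := off_bound I u; rewrite -gu -E w0 first_c uk ck ltnn.
  have [gv1 gvk gvv] := gP v vk; exists (g v); split=> //.
  apply/negP => /imsetP[u /AP[uk uv] E].
  by rewrite (ginj v u vk uk E) ltnn in uv.
apply: (@leq_ltn_trans #|g @: A|); first by rewrite card_in_imset.
apply: proper_card; apply/properP; split; last first.
  by exists w => //; rewrite inE /last_row lt_last // wk eqxx.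
apply/fintype.subsetP => _ /imsetP[u /AP[uk uv] ->]; have [_ guk guu] := gP u uk.
by rewrite inE /last_row (ltn_trans guu uv) lt_last ?guk ?eqxx // (ltn_trans guu).
Qed.

Lemma standard_T_chains_last : standard (T_chains_last I).
Proof.
rewrite T_chains_last_row_tab; apply: standard_row_tab.
- exact: last_row_onto.
- exact: last_row_ballot.
Qed.

End ChainTableau.

(** * Ranks on the space of the reading word *)

Section ColumnsOfRowTableaux.
Variables (n : nat) (rho : 'I_n -> nat).
Hypothesis ballot : forall v k, rho v = k.+1 ->
  (#|[set u | (rho u == k.+1) && (u < v)%N]| < #|[set u | (rho u == k) && (u < v)%N]|)%N.
Implicit Types u v w : 'I_n.

Definition col v : nat := path_pos (@nat_of_ord n) rho v.

Lemma val_rho_inj u v : nat_of_ord u = v -> rho u = rho v -> u = v.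
Proof. by move=> /val_inj. Qed.

Lemma colE v : col v = #|[set u | (rho u == rho v) && (u < v)%N]|.
Proof. by apply: eq_card => u; rewrite !inE. Qed.

(** The ballot condition is given only at members of row k + 1; induction on the prefix extends it
    to all [m], as the left count grows only there. *)
Lemma ballot_prefix k m : (m <= n)%N ->
  (#|[set u | (rho u == k.+1) && (u < m)%N]| <= #|[set u | (rho u == k) && (u < m)%N]|)%N.
Proof.
elim: m => [|m IHm] mn.
  by rewrite (_ : [set u | _] = finset.set0) ?cards0 //; apply/setP => u; rewrite !inE ltn0 andbF.
pose v := Ordinal mn.
have split_m j : #|[set u | (rho u == j) && (u < m.+1)%N]|
    = ((rho v == j) + #|[set u | (rho u == j) && (u < m)%N]|)%N.
  rewrite (cardsD1 v) !inE ltnSn andbT; congr (_ + _)%N; apply: eq_card => u.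
  rewrite !inE ltnS [(u <= m)%N]leq_eqVlt -val_eqE /=.
  by case: ltngtP; rewrite ?andbF ?andbT.
rewrite !split_m; have [vk|_] := eqVneq (rho v) k.+1; last first.
  by rewrite add0n (leq_trans (IHm (ltnW mn))) // leq_addl.
by rewrite (leq_trans (ballot vk)) // leq_addl.
Qed.

Lemma ballot_le j k m : (m <= n)%N -> (j <= k)%N ->
  (#|[set u | (rho u == k) && (u < m)%N]| <= #|[set u | (rho u == j) && (u < m)%N]|)%N.
Proof.
move=> mn; elim: k => [|k IHk]; first by rewrite leqn0 => /eqP->.
rewrite leq_eqVlt => /orP[/eqP->//|]; rewrite ltnS => /IHk.
exact: leq_trans (ballot_prefix k mn).
Qed.

(** Before [v], the row of [v] has at least as many entries as the lower row of [u], and [u] itself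
    is one of the latter. *)
Lemma col_lt u v : (u < v)%N -> (rho v <= rho u)%N -> (col u < col v)%N.
Proof.
move=> uv vu; rewrite [col v]colE; apply: leq_trans (ballot_le (ltnW (ltn_ord v)) vu).
rewrite colE; apply: proper_card; apply/properP; split.
  by apply/fintype.subsetP => w; rewrite !inE => /andP[-> /ltn_trans->].
by exists u; rewrite !inE eqxx ?uv //= ltnn.
Qed.

Lemma row_length_le u v : (rho v <= rho u)%N -> (#|fiber rho u| <= #|fiber rho v|)%N.
Proof.
move=> vu; have fE w : #|fiber rho w| = #|[set x | (rho x == rho w) && (x < n)%N]|.
  by apply: eq_card => x; rewrite !inE ltn_ord andbT.
by rewrite !fE; apply: ballot_le.
Qed.

Variable F : fieldType.
Implicit Types Y : 'M[F]_n.

Definition row_compatible Y : Prop :=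
  forall u v, Y u v != 0 -> (u < v)%N && (rho v <= rho u)%N.

Lemma row_compatible_exp Y k u v : row_compatible Y ->
  (Y ^+ k) u v != 0 -> (col u + k <= col v)%N.
Proof.
move=> Yc; elim: k u => [|k IHk] u.
  rewrite expr0 mxE addn0; case: (u =P v) => [->//|_]; by rewrite eqxx.
rewrite exprS mxE => /eqP; apply: contra_notT; rewrite -ltnNge => h.
rewrite big1 // => w _; have [->|/Yc/andP[uw wu]] := eqVneq (Y u w) 0; first by rewrite mul0r.
have [->|/IHk] := eqVneq ((Y ^+ k) w v) 0; first by rewrite mulr0.
by have := col_lt uw wu; move: h; lia.
Qed.

(** The column of Y^k at a vertex [v] with [col v < k] is 0, which bounds the rank by the number of
    the other vertices. *)
Lemma row_compatible_minor Y k h (f g : 'I_h -> 'I_n) : row_compatible Y ->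
  (#|[set v | (k <= col v)%N]| < h)%N -> \det (mxsub f g (Y ^+ k)) = 0.
Proof.
move=> Yc hk; case: (boolP (injectiveb g)) => [/injectiveP gi|/injectiveP gN]; last first.
  exact: minor_noninj_col.
have [/forallP gall|/forallPn[j]] := boolP [forall j, (k <= col (g j))%N].
  suff : (h <= #|[set v | (k <= col v)%N]|)%N by rewrite leqNgt hk.
  rewrite -[h]card_ord -(card_codom gi); apply: subset_leq_card.
  by apply/fintype.subsetP => _ /codomP[j ->]; rewrite inE.
rewrite -ltnNge => jk; rewrite (expand_det_col _ j) big1 // => i _.
rewrite mxE; have [->|/(row_compatible_exp Yc)] := eqVneq ((Y ^+ k) (f i) (g j)) 0.
  by rewrite mul0r.
by move: jk; lia.
Qed.

End ColumnsOfRowTableaux.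

Section LastRowColumns.
Variables (n : nat) (I : {set 'I_n.-1}) (c r s : nat).
Hypothesis chains_ge2 : (2 <= nchains I)%N.
Hypothesis first_c : chain_length I 0 = c.
Hypothesis last_c : chain_length I (nchains I).-1 = c.
Hypothesis rE : r = #|[set j : 'I_(nchains I) | (c < chain_length I j)%N]|.
Hypothesis sE : (s + 2 * c)%N
  = (\sum_(j < nchains I | (chain_length I j <= c)%N) chain_length I j)%N.

Lemma card_off_eq k : #|[set v | off I v == k]|
  = #|[set j : 'I_(nchains I) | (k < chain_length I j)%N]|.
Proof.
rewrite -sum1_card (partition_big (fun v => Ordinal (chain_index_bound I v)) xpredT) //=.
rewrite -sum1dep_card [RHS]big_mkcond /=; apply: eq_bigr => j _.
have -> : (if (k < chain_length I j)%N then 1 else 0)%N = (k < chain_length I j)%N :> nat.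
  by case: ifP.
rewrite sum1dep_card /chain_length -(@card_rank_eq _ (@nat_of_ord n)); last first.
  by move=> ? ? _ _ /val_inj.
apply: eq_card => v; rewrite !inE -val_eqE /= andbC /off.
by case: eqP => // ->.
Qed.

Lemma card_last_row k : #|[set v | last_row I c v == k]|
  = ((k == c) + (#|[set j : 'I_(nchains I) | (k < chain_length I j)%N]| - (k == c.-1)))%N.
Proof.
have [vn vnE] := last_vertex chains_ge2; have c0 := c_gt0 chains_ge2 first_c.
have vn_off := off_last chains_ge2 first_c last_c vnE.
rewrite -card_off_eq (cardsD1 vn) [in RHS](cardsD1 vn) !inE /last_row vnE eqxx vn_off.
rewrite (eq_sym c) (eq_sym c.-1) addKn; congr (_ + _)%N; apply: eq_card => v.
rewrite !inE -val_eqE /= vnE; case: (nat_of_ord v =P n.-1) => //= _.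
Qed.

Lemma chains_gt k : (k < c)%N ->
  (r + 2 <= #|[set j : 'I_(nchains I) | (k < chain_length I j)%N]|)%N.
Proof.
move=> kc; have l0 : (0 < nchains I)%N by apply: ltnW.
have ll : ((nchains I).-1 < nchains I)%N by rewrite prednK.
pose A := [set j : 'I_(nchains I) | (c < chain_length I j)%N].
have first_last : Ordinal l0 != Ordinal ll.
  by apply/eqP => /(congr1 val) /= E; move: chains_ge2; rewrite /nchains -E.
rewrite rE -/A; have := subset_leq_card (A := mem (Ordinal l0 |: (Ordinal ll |: A))).
move=> /(_ (mem [set j : 'I_(nchains I) | (k < chain_length I j)%N])).
rewrite !cardsU1 !inE (negPf first_last) /= first_c last_c ltnn add1n add1n addn2; apply.
apply/fintype.subsetP => j; rewrite !inE => /or3P[/eqP->|/eqP->|/(ltn_trans kc)//].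
  by rewrite /= first_c.
by rewrite /= last_c.
Qed.

Lemma chains_le k : (c <= k)%N ->
  (#|[set j : 'I_(nchains I) | (k < chain_length I j)%N]| <= r)%N.
Proof.
move=> ck; rewrite rE; apply: subset_leq_card; apply/fintype.subsetP => j.
by rewrite !inE; apply: leq_ltn_trans.
Qed.

(** Rows from c on have at most r + 1 cells, the moved one included, so they do not reach column r +
    1. The c rows above hold s + c + c(r + 1) - 1 cells and each of them has at least r + 1, since
    the first, the last and the r longer chains meet it in T_I. Dropping r + 1 cells per row leaves
    at most s + c - 1. *)
Lemma card_col : (#|[set v | (r.+1 <= col (last_row I c) v)%N]| < s + c)%N.
Proof.
have c0 := c_gt0 chains_ge2 first_c.
pose rho := last_row I c; pose B := [set v | (rho v < c)%N].
have fiberE v : #|fiber rho v| = #|[set u | rho u == rho v]| by apply: eq_card => u; rewrite !inE.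
pose D := [set v | (r.+1 <= col rho v)%N].
have D_B : D \subset B.
  apply/fintype.subsetP => v; rewrite !inE => rv; rewrite ltnNge; apply/negP => cv.
  have := path_pos_bound (@nat_of_ord n) rho v; rewrite -/(col rho v) fiberE card_last_row.
  have := chains_le cv; move: rv; case: (_ == c); case: (_ == c.-1) => /=; lia.
have cardB : #|B| = (s + c + c * r.+1).-1.
  have [vn vnE] := last_vertex chains_ge2.
  have vn_off := off_last chains_ge2 first_c last_c vnE.
  rewrite -(card_off_lt_c rE sE) (cardsD1 vn [set v | (off I v < c)%N]) !inE vn_off.
  have -> : (c.-1 < c)%N by rewrite prednK.
  apply: eq_card => v; rewrite !inE /rho /last_row.
  by rewrite -val_eqE /= vnE; case: (nat_of_ord v =P n.-1) => //= _; rewrite ltnn.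
have ex_cell (ki : 'I_c * 'I_r.+1) : exists v, (rho v == ki.1) && (col rho v == ki.2).
  case: ki => k i; have rowk : (r < #|[set u | rho u == k]|)%N.
    by have := chains_gt (ltn_ord k); rewrite card_last_row; case: (_ == c.-1); lia.
  have /card_gt0P[u] : (0 < #|[set u | rho u == k]|)%N by apply: leq_ltn_trans rowk.
  rewrite inE => /eqP uk; have [|v vu vi] := @path_pos_onto _ (@nat_of_ord n) rho (@val_rho_inj n rho) u i.
    by rewrite fiberE uk (leq_trans (ltn_ord i)).
  by exists v; rewrite vu uk /col vi !eqxx.
pose g ki := xchoose (ex_cell ki).
have gP ki : rho (g ki) = ki.1 /\ col rho (g ki) = ki.2.
  by have /andP[/eqP-> /eqP->] := xchooseP (ex_cell ki).
have ginj : injective g.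
  move=> [k i] [k' i'] E; have [] := gP (k, i); have [] := gP (k', i').
  by rewrite E => -> -> /= /val_inj-> /val_inj->.
have cBD : (c * r.+1 <= #|B :\: D|)%N.
  rewrite -[c in (c * _)%N]card_ord -[r.+1]card_ord -card_prod -(card_codom ginj).
  apply: subset_leq_card; apply/fintype.subsetP => _ /codomP[[k i] ->].
  by have [gk gi] := gP (k, i); rewrite !inE gk gi -ltnNge !ltn_ord.
have := cardsID D B; rewrite (finset.setIidPr D_B) cardB; move: cBD c0; rewrite -/D.
by clear; lia.
Qed.

End LastRowColumns.

(** * Jordan form of a generic element *)

Section JordanForm.
Variables (n : nat) (rho : 'I_n -> nat).
Hypothesis ballot : forall v k, rho v = k.+1 ->
  (#|[set u | (rho u == k.+1) && (u < v)%N]| < #|[set u | (rho u == k) && (u < v)%N]|)%N.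
Variable F : fieldType.
Implicit Types (u v w : 'I_n) (Y : 'M[F]_n) (x z : 'rV[F]_n).

Local Notation row_compatible := (@row_compatible n rho F).

Definition len v : nat := #|fiber rho v|.

(* The direct sum of nilpotent Jordan blocks along the rows of the tableau. *)
Definition jordan_mx : 'M[F]_n := path_mx (@nat_of_ord n) rho F.

Definition next u v : bool := (rho u == rho v) && (col rho v == (col rho u).+1).

Lemma jordan_mxE u v : jordan_mx u v = (next u v)%:R.
Proof. by rewrite mxE /path_step addn1. Qed.

Lemma next_inj u v w : next u v -> next u w -> v = w.
Proof.
move=> /andP[/eqP uv /eqP cv] /andP[/eqP uw /eqP cw].
by apply: (path_pos_inj (@val_rho_inj n rho)); rewrite -?uv //; rewrite -/(col rho v) cv -cw.
Qed.

Lemma col_bound v : (col rho v < len v)%N.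
Proof. exact: path_pos_bound. Qed.

Lemma len_eq u v : rho u = rho v -> len u = len v.
Proof. by move=> /fiber_eq; rewrite /len => ->. Qed.

Lemma cell_onto u i : (i < len u)%N -> exists2 v, rho v = rho u & col rho v = i.
Proof. exact: (path_pos_onto (@val_rho_inj n rho)). Qed.

Lemma col_ltE u v : rho u = rho v -> (col rho u < col rho v)%N = (u < v)%N.
Proof. exact: (path_pos_ltE (@val_rho_inj n rho)). Qed.

Lemma jordan_compatible : row_compatible jordan_mx.
Proof.
move=> u v; rewrite jordan_mxE; case: (boolP (next u v)); rewrite ?eqxx //.
by move=> /andP[/eqP uv /eqP cv] _; rewrite -(col_ltE uv) cv ltnSn uv leqnn.
Qed.

Lemma jordan_nilpotent : jordan_mx ^+ n = 0.
Proof.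
apply/matrixP => u v; rewrite path_mx_exp; last exact: val_rho_inj.
rewrite mxE /path_step; case: eqP => //= _; case: eqP => // E.
have := col_bound v; rewrite /col E ltnNge.
have : (len v <= n)%N by rewrite -[X in (_ <= X)%N]card_ord max_card.
by lia.
Qed.

(* Decreases along the reading word. *)
Definition depth v : nat := (rho v * n + (n - v))%N.

Lemma depth_lt u v : (rho v < rho u)%N || ((rho u == rho v) && (u < v)%N) ->
  (depth v < depth u)%N.
Proof.
move=> uv; rewrite /depth; have := ltn_ord u; have := ltn_ord v; move: uv.
by case/orP => [|/andP[/eqP->]]; nia.
Qed.

Definition supported (S : pred 'I_n) x : Prop := forall v, x 0 v != 0 -> S v.

Lemma supportedD S x z : supported S x -> supported S z -> supported S (x + z).
Proof.
move=> xS zS v; rewrite mxE; have [->|/xS//] := eqVneq (x 0 v) 0.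
by rewrite add0r => /zS.
Qed.

Lemma supportedZ S a x : supported S x -> supported S (a *: x).
Proof. by move=> xS v; rewrite mxE => h; apply: xS; apply: contra_neq h => ->; rewrite mulr0. Qed.

Lemma supported0 S : supported S 0.
Proof. by move=> v; rewrite mxE eqxx. Qed.

Section Generic.
Variable Y : 'M[F]_n.
Hypothesis Yc : row_compatible Y.
Hypothesis Ynext : forall u v, next u v -> Y u v != 0.

Definition image_of S z : Prop := exists2 x, supported S x & x *m Y = z.

Lemma image_of_sum S (c : 'I_n -> F) (z : 'I_n -> 'rV[F]_n) (P : pred 'I_n) :
  (forall v, P v -> c v != 0 -> image_of S (z v)) ->
  image_of S (\sum_(v | P v) c v *: z v).
Proof.
move=> cz; apply: (big_ind (image_of S)) => [|_ _ [x xS <-] [y yS <-]|v Pv].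
- by exists 0; [apply: supported0 | rewrite mul0mx].
- by exists (x + y); [apply: supportedD | rewrite mulmxDl].
have [->|/(cz v Pv)[x xS <-]] := eqVneq (c v) 0.
  by exists 0; [apply: supported0 | rewrite mul0mx scale0r].
by exists (c v *: x); [apply: supportedZ | rewrite scalemxAl].
Qed.

Lemma compatible_col u v : Y u v != 0 -> (rho v <= rho u)%N /\ (col rho u < col rho v)%N.
Proof. by move=> /Yc/andP[uv vu]; split=> //; apply: col_lt. Qed.

Local Notation cells m q := (fun w => (m < len w)%N && (q <= col rho w)%N).

(** Row w of [Y], for the left neighbour w of [u], is a multiple of the unit vector at [u] plus
    terms in higher rows or further right in the same row. Those have smaller depth and lie in rows
    at least as long, so induction removes them. *)
Lemma delta_in_image m q u : (m < len u)%N -> (q < col rho u)%N ->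
  image_of (cells m q) (delta_mx 0 u).
Proof.
have [k uk] := ubnP (depth u); elim: k u uk => // k IHk u uk mu qu.
have [|w wu wc] := @cell_onto u (col rho u).-1.
  by apply: leq_ltn_trans (col_bound u); apply: leq_pred.
have wn : next w u by rewrite /next wu wc eqxx prednK ?eqxx // (leq_ltn_trans _ qu).
have [x xS xE] : image_of (cells m q) (\sum_(v | v != u) Y w v *: delta_mx 0 v).
  apply: image_of_sum => v vu /compatible_col[vw wcv]; rewrite wu in vw.
  apply: IHk.
  - apply: (leq_trans (depth_lt _) uk).
    move: vw; rewrite leq_eqVlt => /orP[/eqP vw|->//]; apply/orP; right.
    rewrite vw eqxx /= -(col_ltE (esym vw)) ltn_neqAle.
    apply/andP; split; last by move: wcv qu; rewrite wc; lia.
    by apply: contra_neq vu => E; apply: (path_pos_inj (@val_rho_inj n rho)).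
  - by apply: leq_trans mu _; apply: row_length_le.
  - by move: wcv qu; rewrite wc; lia.
exists ((Y w u)^-1 *: (delta_mx 0 w - x)).
  apply: supportedZ; rewrite -scaleN1r; apply: supportedD; last exact: supportedZ.
  move=> v; rewrite mxE eqxx /=; case: (v =P w) => [-> _|_]; rewrite ?eqxx //.
  by rewrite (len_eq wu) mu wc -ltnS prednK // (leq_ltn_trans _ qu).
rewrite -scalemxAl mulmxBl xE -rowE {1}[row w Y]row_sum_delta (bigD1 u) //= mxE.
under eq_bigr do rewrite mxE.
by rewrite addrK scalerA mulVf ?scale1r // Ynext.
Qed.

Lemma supported_in_image m q z : supported (cells m q.+1) z -> image_of (cells m q) z.
Proof.
move=> zS; rewrite [z]row_sum_delta; apply: image_of_sum => v _ /zS/andP[mv qv].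
exact: delta_in_image.
Qed.

Lemma supported_in_image_exp m i z : supported (cells m i) z ->
  exists2 x, supported (fun w => m < len w)%N x & x *m (Y ^+ i) = z.
Proof.
elim: i z => [|i IHi] z zS.
  by exists z; [move=> v /zS/andP[] | rewrite expr0 mulmx1].
have [x /IHi[y yS <-] <-] := supported_in_image zS.
by exists y; rewrite // exprSr mulmxA.
Qed.

(* A first cell of a row corrected by vectors of longer rows, so that it generates
   a Jordan block of the length of the row. *)
Lemma row_killer u : exists2 x, supported (fun w => rho w < rho u)%N x
  & (delta_mx 0 u - x) *m (Y ^+ len u) = 0.
Proof.
(* After [len u] steps only columns from [len u] on are reached. They occur only in rows longer than
   that of [u], from which the correction [x] is taken; longer rows lie strictly above. *)
have [|x xS xE] := @supported_in_image_exp (len u) (len u) (delta_mx 0 u *m (Y ^+ len u)).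
  move=> v; rewrite -rowE mxE => /(row_compatible_exp ballot Yc) cv.
  have lv : (len u <= col rho v)%N by apply: leq_trans cv; apply: leq_addl.
  by rewrite lv (leq_ltn_trans lv (col_bound v)).
exists x; last by rewrite mulmxBl xE subrr.
move=> w /xS; rewrite ltnNge => uw; rewrite ltnNge; apply: contra uw.
exact: row_length_le.
Qed.

(** Together with [killer_diag] this makes the Jordan basis triangular along the reading order, with
    the cell in column i of the row of [u] on the diagonal. *)
Lemma killer_triangular u x i w : supported (fun w => rho w < rho u)%N x -> col rho u = 0%N ->
  ((delta_mx 0 u - x) *m (Y ^+ i)) 0 w != 0 ->
  (rho w < rho u)%N || (rho w == rho u) && (i <= col rho w)%N.
Proof.
move=> xS u0; elim: i w => [|i IHi] w.
  rewrite expr0 mulmx1 !mxE eqxx /=; case: (w =P u) => [->|_]; first by rewrite eqxx orbT.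
  by rewrite sub0r oppr_eq0 => /xS->.
rewrite exprSr mulmxA mxE; apply: contra_neqT => N; rewrite big1 // => j _; set a := (_ *m _) 0 j.
have [->|/IHi ja] := eqVneq a 0; first by rewrite mul0r.
have [->|/compatible_col[wj cjw]] := eqVneq (Y j w) 0; first by rewrite mulr0.
case/negP: N; case/orP: ja => [ju|/andP[/eqP ju ij]].
  by rewrite (leq_ltn_trans wj ju).
move: wj; rewrite ju leq_eqVlt => /orP[/eqP wu|->//].
by rewrite wu eqxx (leq_ltn_trans ij cjw) orbT.
Qed.

Lemma killer_diag u x i v : supported (fun w => rho w < rho u)%N x -> col rho u = 0%N ->
  rho v = rho u -> col rho v = i -> ((delta_mx 0 u - x) *m (Y ^+ i)) 0 v != 0.
Proof.
move=> xS u0; elim: i v => [|i IHi] v vu vi.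
  have -> : v = u by apply: (path_pos_inj (@val_rho_inj n rho)); rewrite // -/(col rho v) vi.
  rewrite expr0 mulmx1 !mxE !eqxx /=.
  by have [->|/xS] := eqVneq (x 0 u) 0; rewrite ?subr0 ?oner_eq0 // ltnn.
have [|w wu wc] := @cell_onto u i; first by rewrite -(len_eq vu) (leq_trans _ (col_bound v)) // vi.
rewrite exprSr mulmxA mxE (bigD1 w) //= big1 ?addr0 => [|j jw].
  by rewrite mulf_neq0 ?IHi // Ynext // /next wu vu vi wc !eqxx.
set a := (_ *m _) 0 j.
have [->|/killer_triangular ja] := eqVneq a 0; first by rewrite mul0r.
have [->|/compatible_col[vj cjv]] := eqVneq (Y j v) 0; first by rewrite mulr0.
have /orP[ju|/andP[/eqP ju ij]] := ja xS u0; first by move: vj; rewrite vu leqNgt ju.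
case/eqP: jw; apply: (path_pos_inj (@val_rho_inj n rho)); first by rewrite ju wu.
by rewrite -/(col rho j) -/(col rho w) wc; move: cjv ij; rewrite vi; lia.
Qed.

Lemma conj_to_jordan : exists2 P : 'M[F]_n, P \in unitmx & P *m Y = jordan_mx *m P.
Proof.
pose fst v := odflt v [pick u | (rho u == rho v) && (col rho u == 0%N)].
have fstP v : rho (fst v) = rho v /\ col rho (fst v) = 0%N.
  rewrite /fst; case: pickP => [u /andP[/eqP + /eqP]//|N].
  have [|u uv u0] := @cell_onto v 0; first exact: leq_ltn_trans (col_bound v).
  by have := N u; rewrite uv u0 !eqxx.
have fst_eq v w : rho v = rho w -> fst v = fst w.
  move=> vw; have [rv cv] := fstP v; have [rw cw] := fstP w.
  apply: (path_pos_inj (@val_rho_inj n rho)); first by rewrite rv rw.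
  by rewrite -/(col rho _) cv -/(col rho _) cw.
have [x xS xK] := fin_all_exists2 row_killer.
pose b v : 'rV[F]_n := delta_mx 0 (fst v) - x (fst v).
(* The Jordan basis: the corrected first cell of each row and its images under powers of [Y]. *)
pose P : 'M[F]_n := \matrix_v (b v *m (Y ^+ col rho v)).
have PE v w : P v w = (b v *m (Y ^+ col rho v)) 0 w.
  by have /rowP/(_ w) := rowK (fun v => b v *m (Y ^+ col rho v)) v; rewrite mxE.
exists P.
  (* The kernel equation at [v] has a non-zero coefficient at [v] and otherwise involves only cells
     of smaller depth. *)
  rewrite -unitmx_tr -row_free_unit; apply: inj_row_free => z zP.
  apply/rowP => v; rewrite [RHS]mxE; have [k vk] := ubnP (depth v).
  elim: k v vk => // k IHk v vk; have /rowP/(_ v) := zP.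
  have [rv cv] := fstP v.
  rewrite !mxE (bigD1 v) //= big1 ?addr0 => [/eqP|w wv].
    rewrite mxE mulf_eq0 PE => /orP[/eqP//|].
    by rewrite (negPf (killer_diag (xS _) cv _ _)).
  rewrite mxE PE; set a := (_ *m _) 0 w.
  have [->|/(killer_triangular (xS _) cv)] := eqVneq a 0; first by rewrite mulr0.
  rewrite rv => vw; rewrite IHk ?mul0r //; apply: (leq_trans (depth_lt _) vk).
  case/orP: vw => [->//|/andP[/eqP wv' cvw]]; apply/orP; right.
  rewrite wv' eqxx -(col_ltE (esym wv')) ltn_neqAle cvw andbT.
  by apply: contra_neq wv => E; apply: (path_pos_inj (@val_rho_inj n rho)).
apply/row_matrixP => v; rewrite !row_mul rowK -mulmxA -[_ *m Y]/(_ * Y) -exprSr.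
have rowN w : row v jordan_mx 0 w = (next v w)%:R by rewrite -jordan_mxE [LHS]mxE.
rewrite [RHS]mulmx_sum_row.
have [cv|cv] := ltnP (col rho v).+1 (len v).
  have [w wv wc] := cell_onto cv; have vw : next v w by rewrite /next wv wc !eqxx.
  rewrite (bigD1 w) //= big1 ?addr0 => [|u uw].
    by rewrite rowN vw scale1r rowK wc /b (fst_eq _ _ wv).
  rewrite rowN; case: (boolP (next v u)) => [/(next_inj vw) wu|_]; last by rewrite scale0r.
  by rewrite wu eqxx in uw.
have cvE : (col rho v).+1 = len (fst v).
  by rewrite (len_eq (fstP v).1); apply/eqP; rewrite eqn_leq cv col_bound.
rewrite cvE xK big1 // => u _; rewrite rowN.
case: (boolP (next v u)) => [/andP[/eqP vu /eqP cu]|_]; last by rewrite scale0r.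
by have := col_bound u; rewrite cu -(len_eq vu) ltnNge cv.
Qed.

End Generic.
End JordanForm.

(** * The highest common divisor *)

Section PermutationWords.
Variables (F : numFieldType) (n : nat).
Implicit Types (w : 'S_n) (X : 'M[F]_n).

Definition perm_word w : seq nat := [seq nat_of_ord (w i) | i <- enum 'I_n].

Lemma size_perm_word w : size (perm_word w) = n.
Proof. by rewrite size_map size_enum_ord. Qed.

Lemma nth_perm_word w (i : 'I_n) : nth 0%N (perm_word w) i = w i.
Proof. by rewrite (nth_map i) ?size_enum_ord // nth_ord_enum. Qed.

Lemma uniq_perm_word w : uniq (perm_word w).
Proof. by rewrite map_inj_uniq ?enum_uniq // => i j /val_inj/perm_inj. Qed.

Lemma perm_word_iota w : perm_eq (perm_word w) (iota 0 n).
Proof.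
apply: uniq_perm; rewrite ?uniq_perm_word ?iota_uniq // => x; rewrite mem_iota /= add0n.
apply/mapP/idP => [[i _ ->]|xn]; first exact: ltn_ord.
by exists ((w^-1)%g (Ordinal xn)); rewrite ?mem_enum // permKV.
Qed.

Lemma index_perm_word w (i : 'I_n) : index (nat_of_ord i) (perm_word w) = (w^-1)%g i.
Proof.
have -> : nat_of_ord i = nth 0%N (perm_word w) ((w^-1)%g i) by rewrite nth_perm_word permKV.
by rewrite index_uniq ?uniq_perm_word // size_perm_word.
Qed.

Lemma n_cap_word_space w X : n_cap w X <-> word_space (perm_word w) X.
Proof.
split=> h i j; rewrite /before.
  rewrite !index_perm_word; apply: contraR => ij.
  by apply/eqP; apply: h.
by move=> ij; apply/eqP; apply: contraR ij => /h; rewrite /before !index_perm_word.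
Qed.

Lemma perm_word_onto s : perm_eq s (iota 0 n) -> exists w, perm_word w = s.
Proof.
move=> sn; have ss : size s = n by rewrite (perm_size sn) size_iota.
have us : uniq s by rewrite (perm_uniq sn) iota_uniq.
have lt_n (i : 'I_n) : (nth 0%N s i < n)%N.
  have : nth 0%N s i \in s by rewrite mem_nth // ss.
  by rewrite (perm_mem sn) mem_iota.
have inj : injective (fun i => Ordinal (lt_n i)).
  move=> i j /(congr1 val) /= /eqP; rewrite nth_uniq ?ss // => /eqP.
  exact: val_inj.
exists (perm inj); apply: (@eq_from_nth _ 0%N); first by rewrite size_perm_word.
move=> i; rewrite size_perm_word => ni.
by rewrite (nth_perm_word _ (Ordinal ni)) permE.
Qed.

End PermutationWords.

Section HighestCommonDivisor.
Variables (F : numFieldType) (n : nat) (I : {set 'I_n.-1}) (c r s : nat).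
Hypothesis chains_ge2 : (2 <= nchains I)%N.
Hypothesis first_c : chain_length I 0 = c.
Hypothesis last_c : chain_length I (nchains I).-1 = c.
Hypothesis mid_c : forall j, (0 < j)%N -> (j < (nchains I).-1)%N -> chain_length I j <> c.
Hypothesis rE : r = #|[set j : 'I_(nchains I) | (c < chain_length I j)%N]|.
Hypothesis sE : (s + 2 * c)%N
  = (\sum_(j < nchains I | (chain_length I j <= c)%N) chain_length I j)%N.
Implicit Types (f g q : S_nilrad F I) (b X Y : 'M[F]_n).

Local Notation common_divisor := (divides_minors (s + c) (M_nilrad F I ^+ r.+1)).
Local Notation row := (last_row I c).
Local Notation T := (T_chains_last I).

Let ballot := @last_row_ballot n I c chains_ge2 first_c last_c.

Lemma reading_word_iota : perm_eq (reading T) (iota 0 n).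
Proof.
rewrite (T_chains_last_row_tab chains_ge2 first_c last_c).
by apply: perm_reading_row_tab => v; apply: last_row_lt.
Qed.

Lemma reading_word_space Y : word_space (reading T) Y <-> row_compatible row Y.
Proof.
rewrite (T_chains_last_row_tab chains_ge2 first_c last_c).
have beforeE (u v : 'I_n) : (u < v)%N -> before (reading (row_tab row (tab_height I c))) u v
    = (row v <= row u)%N.
  by apply: before_row_tab => w; apply: last_row_lt.
split=> h u v /h /andP[uv vu]; rewrite uv.
  by rewrite -beforeE.
by rewrite beforeE.
Qed.

(** Along a chain the rows strictly increase, also after the last vertex has moved down, so a
    compatible entry never joins two vertices of one chain. *)
Lemma row_compatible_in_m Y : row_compatible row Y -> in_m I Y.
Proof.
move=> Yc u v /Yc/andP[uv vu]; rewrite /in_nilrad ltn_neqAle.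
rewrite chain_index_mono ?(ltnW uv) // andbT; apply/eqP => cuv.
have : (off I u < off I v)%N by rewrite off_ltE.
move: vu; rewrite /last_row.
have -> : (val u == n.-1) = false.
  by have := ltn_ord v; move: uv => /=; clear; lia.
case: eqP => [vn|_]; last by rewrite leqNgt => /negPf->.
have := off_bound I u; rewrite cuv chain_index_last // last_c => uc.
by rewrite leqNgt uc.
Qed.

Lemma in_m_conj b Y : group_B b -> in_m I Y -> in_m I (b *m Y *m invmx b).
Proof.
move=> [bu /is_trig_mxP bt] Ym u v; apply: contraR => uv.
have /is_trig_mxP bit : is_trig_mx (invmx b)^T.
  apply: (@trig_inverse _ _ b^T); last exact/is_trig_mxP.
  by rewrite -trmx_mul mulVmx // trmx1.
rewrite mxE big1 // => j _; have [vj|jv] := ltnP v j.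
  by have := bit v j vj; rewrite mxE => ->; rewrite mulr0.
rewrite mxE big1 ?mul0r // => i _; have [iu|ui] := ltnP i u.
  by have := bt i u iu; rewrite mxE => ->; rewrite mul0r.
have [->|/Ym ij] := eqVneq (Y i j) 0; first by rewrite mulr0.
case/negP: uv; apply: leq_ltn_trans (chain_index_mono I ui) _.
exact: leq_trans ij (chain_index_mono I jv).
Qed.

Lemma eval_nilrad_mxeval g : exists p : {mpoly F[n * n]}, forall X, mxeval p X = eval_nilrad X g.
Proof.
exists (comp_mpoly [tuple - 'X_(mxvec_index (src k) (tgt k)) | k < #|Defs.coord I|] g).
move=> X; rewrite /mxeval comp_mpoly_meval; apply: meval_eq => k.
by rewrite tnth_mktuple mevalN mevalXU mxvecE.
Qed.

(** [V_tab] admits every [w] with [Q w = T]; Knuth equivalence carries the vanishing from the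
    reading word to each of them. *)
Lemma mem_vanishing_ideal g :
  (forall b Y, group_B b -> row_compatible row Y -> eval_nilrad (b *m Y *m invmx b) g = 0) ->
  vanishing_ideal (zariski_closure (V_tab (n:=n) T)) g.
Proof.
move=> g0 X; have [p pE] := eval_nilrad_mxeval g; rewrite -pE; apply => X' [w [Qw [O [_ _ + _]]]].
apply => _ [b [Y [bB Yw ->]]]; rewrite -/(mxeval _ _).
have [_] := vanishes_on_RS p (perm_word_iota w) reading_word_iota
  (etrans Qw (esym (RS_reading (standard_T_chains_last chains_ge2 first_c last_c)))).
apply=> // [b' Y' b'B /reading_word_space Y'c|]; first by rewrite pE g0.
exact/n_cap_word_space.
Qed.

Lemma minor_in_vanishing_ideal (f' g' : 'I_(s + c) -> 'I_n) :
  vanishing_ideal (zariski_closure (V_tab (n:=n) T))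
    (\det (mxsub f' g' (M_nilrad F I ^+ r.+1))).
Proof.
apply: mem_vanishing_ideal => b Y bB Yc; apply/eqP; rewrite eval_minor; last first.
  exact/in_m_conj/row_compatible_in_m.
have bu : b \in unitmx by case: bB.
have powE k : (b *m Y *m invmx b) ^+ k = b *m (Y ^+ k) *m invmx b.
  elim: k => [|k IHk]; first by rewrite !expr0 mulmx1 mulmxV.
  by rewrite !exprS IHk -!mulmxE !mulmxA mulmxKV.
have : divides_minors (s + c) (b *m (Y ^+ r.+1) *m invmx b) 0.
  apply: divides_minors_mulr; apply: divides_minors_mull => f g; exists 0; rewrite mul0r.
  apply: (row_compatible_minor ballot _ _ Yc); exact: card_col.
by move=> /(_ g' f')[q]; rewrite powE mulr0 => ->.
Qed.

(** Let U be the set of vertices in rows from c on. A compatible [Y] has no arrow into U, so a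
    non-zero value would force a total weight at least 0. But the last vertex has weight -1, and the
    others in U belong to chains longer than c, of weight 0. *)
Lemma end_wt_vanishes g Y : wt g (end_wt I true) -> row_compatible row Y ->
  eval_nilrad Y g = 0.
Proof.
move=> wtg Yc; apply/eqP/negPn/negP => gY.
have [vn vnE] := last_vertex chains_ge2.
have := wt_exit_ge0 (U := fun v => (c <= row v)%N) wtg gY.
rewrite (bigD1 vn) /=; last by rewrite /last_row vnE eqxx.
rewrite (end_wt_last chains_ge2) // big1 ?addr0 => [h|v /andP[cv vvn]].
  suff : (0 <= -1 :> int) by [].
  by apply: h => u v /Yc/andP[_ vu] /leq_trans; apply.
have vN : (val v == n.-1) = false by rewrite -vnE; apply/negbTE.
have := off_bound I v; rewrite /end_wt mul1r.
move: cv; rewrite /last_row vN.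
case: eqP => [->|_]; first by rewrite first_c leqNgt => /negPf->.
by case: eqP => [->|_]; first by rewrite last_c leqNgt => /negPf->.
Qed.

(** A translate of [g] is again a common divisor. Either it has weight 1 on the first chain and
    [end_wt_vanishes] applies, or it is constant; then [g] is constant too, against its weight. *)
Lemma end_wt_true_in_vanishing_ideal g : common_divisor g -> wt g (end_wt I true) ->
  vanishing_ideal (zariski_closure (V_tab (n:=n) T)) g.
Proof.
move=> gd wtg; apply: mem_vanishing_ideal => b Y [bu bt] Yc.
pose P := (invmx b)^T; pose Q := b^T.
have PQ : P *m Q = 1%:M by rewrite -trmx_mul mulmxV ?trmx1.
have Pt : is_trig_mx P by apply: trig_inverse bt; apply: mulmx1C.
have -> : b *m Y *m invmx b = Q^T *m Y *m P^T by rewrite !trmxK.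
rewrite -eval_adjoint; last exact: row_compatible_in_m.
have ad : common_divisor (adjoint P Q g) by apply: divides_minors_adjoint.
have [[] wta] := common_divisor_wt chains_ge2 first_c last_c mid_c rE sE ad.
  exact: end_wt_vanishes.
have g0 := common_divisor_neq0 rE sE gd.
have gC : g = ((adjoint P Q g)@_0)%:MP.
  by rewrite -[LHS](adjointK PQ Pt bt) (end_wt0_const wta) /adjoint comp_mpolyC mcoeffC eqxx mulr1.
have [vn vnE] := last_vertex chains_ge2.
have : wt g (fun=> 0).
  move=> m; rewrite gC => mg v; exact: (@ihomogC _ _ (edge_weight 0 _) _ m mg).
move=> /(wt_uniq g0 wtg)/(_ vn); rewrite (end_wt_last chains_ge2) //.
Qed.

Lemma V_tab_nonempty : exists X : 'M[F]_n, V_tab T X.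
Proof.
have [w wE] := perm_word_onto reading_word_iota.
pose N := jordan_mx row F.
have capE X : n_cap w X <-> row_compatible row X.
  by rewrite n_cap_word_space wE; apply: reading_word_space.
have Nc : row_compatible row N by apply: jordan_compatible.
have one_conj X : 1%:M *m X *m invmx 1%:M = X by rewrite mul1mx invmx1 mulmx1.
exists N, w; split.
  by rewrite -[RHS](RS_reading (standard_T_chains_last chains_ge2 first_c last_c)) -wE.
exists (conj_set (@group_G F n) (set1 N)); split.
- by exists N; split=> //; exists n; apply: jordan_nilpotent.
- split=> [_ [h [_ [hu -> ->]]]|_ [h [Y [hu /capE Yc ->]]] p p0].
    by exists h, N; split=> //; apply/capE.
  (* Outside these values all entries of [Y + tau *: N] between neighbours in a row are non-zero, so
     this matrix is conjugate to [N]; hence the orbit of [N] is dense. *)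
  pose bad := [seq - Y uv.1 uv.2 | uv : 'I_n * 'I_n].
  apply: (@mxeval_line_eq0 _ _ _ _ (h *m N *m invmx h) bad) => tau taubad.
  have -> : h *m Y *m invmx h + tau *: (h *m N *m invmx h) = h *m (Y + tau *: N) *m invmx h.
    by rewrite mulmxDr mulmxDl -scalemxAr -scalemxAl.
  have [||P Pu PY] := @conj_to_jordan _ _ ballot _ (Y + tau *: N).
  - move=> u v; rewrite mxE [(tau *: N) u v]mxE; have [Y0|/Yc//] := eqVneq (Y u v) 0.
    by rewrite Y0 add0r => tN; apply: Nc; apply: contra_neq tN => ->; rewrite mulr0.
  - move=> u v uv; rewrite mxE [(tau *: N) u v]mxE jordan_mxE uv mulr1.
    rewrite addrC addr_eq0; apply: contraNneq taubad => ->.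
    by apply/fintype.imageP; exists (u, v).
  apply: p0; exists (h *m invmx P), N; split=> //.
    by rewrite /group_G unitmx_mul hu unitmx_inv.
  have -> : Y + tau *: N = invmx P *m N *m P by rewrite -mulmxA -PY mulKmx.
  have -> : invmx (h *m invmx P) = P *m invmx h.
    have E : (P *m invmx h) *m (h *m invmx P) = 1%:M by rewrite mulmxA mulmxKV // mulmxV.
    by rewrite -[RHS](@mulmxK _ _ _ (h *m invmx P)) ?E ?mul1mx // unitmx_mul hu unitmx_inv.
  by rewrite !mulmxA.
- move=> p p0; apply: p0; exists 1%:M, N; split=> //; last exact/capE.
  by split; [apply: unitmx1 | rewrite trmx1 scalar_mx_is_trig].
- by exists 1%:M, N; split=> //; apply: unitmx1.
Qed.

Lemma divides_const g f a : g = a%:MP -> g != 0 -> divides g f.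
Proof.
move=> ->; rewrite mpolyC_eq0 => a0; exists (f * a^-1%:MP).
by rewrite -mulrA -mpolyCM mulVf // mulr1.
Qed.

Lemma generator_is_hcd f :
  generates f (vanishing_ideal (zariski_closure (V_tab (n:=n) T))) ->
  is_hcd f (nonzero_minor (s + c) (M_nilrad F I ^+ r.+1)).
Proof.
move=> fJ; have wt_cd g := @common_divisor_wt F n I c r s chains_ge2 first_c last_c mid_c rE sE g.
have neq0 g := @common_divisor_neq0 F n I c r s rE sE g.
have fd : common_divisor f by move=> f' g'; apply/fJ; apply: minor_in_vanishing_ideal.
have [vn vnE] := last_vertex chains_ge2.
have f1 : wt f (end_wt I true).
  (* A generator of weight 0 would be a non-zero constant vanishing at a point of the orbital
     variety. *)
  have [[]// /end_wt0_const fC] := wt_cd f fd.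
  have [X XT] := V_tab_nonempty.
  have : eval_nilrad X f = 0.
    have [_ ] := fJ f; apply; first by exists 1; rewrite mul1r.
    by move=> p p0; apply: p0.
  rewrite fC /eval_nilrad mevalC => fC0; have := neq0 f fd.
  by rewrite fC fC0 mpolyC0 eqxx.
split=> [d|g]; first by have [_ h] := divides_minorsP (s + c) (M_nilrad F I ^+ r.+1) f; apply: h.
move=> /divides_minorsP gd; have [[] wtg] := wt_cd g gd; last first.
  exact: divides_const (end_wt0_const wtg) (neq0 g gd).
have [q gE] : divides f g by apply/fJ; apply: end_wt_true_in_vanishing_ideal.
have qd : common_divisor q by apply: (@divides_minors_factor _ _ _ _ _ f); rewrite -gE.
(* If [q] had weight 1 on the first chain as well, [q * f] would have weight -2 at the last vertex,
   where [g] has -1. *)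
have [[] wtq] := wt_cd q qd.
  have := wt_uniq (neq0 g gd) wtg; rewrite gE => /(_ _ (wtM wtq f1) vn).
  by rewrite !(end_wt_last chains_ge2).
have [u uE] := divides_const f (end_wt0_const wtq) (neq0 q qd).
have q0 := neq0 q qd; have qC := end_wt0_const wtq.
exists ((q@_0)^-1%:MP); rewrite gE mulrA [X in _ * X * _]qC -mpolyCM mulVf ?mul1r //.
by apply: contraNneq q0 => q00; rewrite qC q00 mpolyC0.
Qed.

End HighestCommonDivisor.

Theorem proposition3p16 (R : realType) (n : nat) (I : {set 'I_n.-1})
    (c r s : nat) (f : S_nilrad R[i] I) :
  (2 <= nchains I)%N ->
  chain_length I 0 = c ->
  chain_length I (nchains I).-1 = c ->
  (forall j : nat, (0 < j)%N -> (j < (nchains I).-1)%N -> chain_length I j <> c) ->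
  r = #|[set j : 'I_(nchains I) | (c < chain_length I j)%N]| ->
  (s + 2 * c)%N = (\sum_(j < nchains I | (chain_length I j <= c)%N) chain_length I j)%N ->
  generates f
    (vanishing_ideal (zariski_closure (V_tab (n:=n) (T_chains_last I)))) ->
  is_hcd f (nonzero_minor (s + c) (M_nilrad R[i] I ^+ r.+1)).
Proof.
move=> chains_ge2 first_c last_c mid_c rE sE.
exact: (generator_is_hcd chains_ge2 first_c last_c mid_c rE sE).
Qed.
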